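(* Let $(\mathbb{B},\|\cdot\|)$ be a separable $\beta$-smooth Banach space and let $(X_n)_{n\ge1}$ be $\mathbb{B}$-valued random variables adapted to a filtration $(\mathcal{F}_n)_{n\ge0}$ with $\mathbb{E}(X_n\mid\mathcal{F}_{n-1})=\mu$ for all $n\ge1$ (some unknown $\mu\in\mathbb{B}$) and $\sup_{n\ge1}\mathbb{E}(\|X_n-\mu\|^p\mid\mathcal{F}_{n-1})\le v<\infty$ for known $p\in(1,2]$, $v>0$. Let $h:\mathbb{R}_{\ge0}\to\mathbb{R}_{\ge0}$ satisfy $\sum_{n=1}^\infty h(n)^{-1}\le1$, let $n_0$ be a positive integer, and let $k:\mathbb{N}_0\to\mathbb{N}_0$ be increasing with (i) $k(\lfloor\log_2 n\rfloor)=o(n)$ and (ii) $k(\ell)\le\ell/2$ for all $\ell\ge n_0$. Let $\widehat{Z}_j:=\widehat{Z}(X_1,\dots,X_{k(j)})$ for a fixed measurable map $\widehat{Z}$, and suppose $r:(0,1)\times\mathbb{N}_0\to\mathbb{R}$ satisfies $\mathbb{P}(\|\widehat{Z}_j-\mu\|\ge r(\delta,k(j)))\le\delta$ for all $\delta\in(0,1)$ and $j\in\mathbb{N}_0$. Fix $\delta\in(0,1)$ and for $j\ge1$ set $\delta_j:=\delta/h(j)$, \[ \mathfrak{C}_p(j):=\big(\beta\mathfrak{C}_p(\mathbb{B})+2^{p-1}K_p\big)\big(v+r(\delta_j/2,k(j))^p\big),\qquad \lambda_j:=\left(\frac{\beta\log(4/\delta_j)}{2^j\mathfrak{C}_p(j)}\right)^{1/p},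 \] \[ \widehat{\mu}_n(j):=\frac{1}{n-k(j)}\sum_{m=k(j)}^n\left\{\mathtt{Trunc}(\lambda_j(X_m-\widehat{Z}_j))(X_m-\widehat{Z}_j)+\widehat{Z}_j\right\}, \] and $\widehat{\mu}_n:=\widehat{\mu}_n(j)$ for the unique $j\ge1$ with $n\in[2^j,2^{j+1})$. Then with probability at least $1-\delta$, simultaneously for all $n\ge n_0$, \[ \|\widehat{\mu}_n-\mu\|\le\mathfrak{B}_p(\mathbb{B})(v+r_n^p)^{1/p}\left(\beta\frac{\log\!\big(4h(\lfloor\log_2 n\rfloor)/\delta\big)}{n-k(\lfloor\log_2 n\rfloor)}\right)^{(p-1)/p}, \] where $r_n:=r\big(h(\lfloor\log_2 n\rfloor)^{-1}\delta/2,\,k(\lfloor\log_2 n\rfloor)\big)$ and $\mathfrak{B}_p(\mathbb{B}):=[2^{(p-1)/p}+2^{1/p}](\beta\mathfrak{C}_p(\mathbb{B})+K_p2^{p-1})^{1/p}$.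
   Context: $\beta$-smooth: the norm $f=\|\cdot\|$ satisfies $f(0)=0$, $|f(x+y)-f(x)|\le\|y\|$ and $f^2(x+y)+f^2(x-y)\le2f^2(x)+2\beta^2\|y\|^2$ for all $x,y$. $\mathtt{Trunc}(x):=\min\{1,1/\|x\|\}$ ($\mathtt{Trunc}(0)=1$). $K_p:=\frac1p\left(\frac{p-1}{p}\right)^{p-1}$. $\mathfrak{C}_p(\mathbb{B}):=2^{p-1}\frac{e^{2/\beta}-2/\beta-1}{(2/\beta)^2}$ if $\mathbb{B}$ is a Hilbert space and $\mathfrak{C}_p(\mathbb{B}):=2^{p+1}\frac{e^{2/\beta}-2/\beta-1}{(2/\beta)^2}$ otherwise.
   Formalization: The sum defining the estimator runs over m = k(j)+1,…,n (with lower index k(j), X_0 may be undefined and the n−k(j)+1 terms do not match the factor 1/(n−k(j)), so the bound fails for large μ), and the bound is stated for n ≥ max(n_0, 2), since no j ≥ 1 exists for n = 1. *)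

(* Defs.v *)
From mathcomp Require Import all_boot all_order all_algebra.
From mathcomp Require Import all_classical all_reals all_analysis.
Import Order.TTheory GRing.Theory Num.Theory.
Import numFieldNormedType.Exports.
Local Open Scope classical_set_scope.
Local Open Scope ring_scope.

Set Implicit Arguments.
Unset Strict Implicit.
Unset Printing Implicit Defensive.

Section Defs.
Variable R : realType.

(* beta-smoothness of the norm, as in the paper (f = norm). *)
Definition beta_smooth (B : normedModType R) (beta : R) : Prop :=
  `|(0 : B)| = 0 /\
  (forall x y : B, `| `|x + y| - `|x| | <= `|y|) /\
  (forall x y : B,
     `|x + y| ^+ 2 + `|x - y| ^+ 2 <= 2 * `|x| ^+ 2 + 2 * beta ^+ 2 * `|y| ^+ 2).

Definition separable (T : topologicalType) : Prop :=
  exists D : set T, countable D /\ dense D.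

Definition is_hilbert (B : normedModType R) : Prop :=
  exists ip : B -> B -> R,
    (forall x y, ip x y = ip y x) /\
    (forall a x1 x2 y, ip (a *: x1 + x2) y = a * ip x1 y + ip x2 y) /\
    (forall x, ip x x = `|x| ^+ 2).

Definition clf (B : normedModType R) (f : B -> R) : Prop :=
  (forall (a : R) (x y : B), f (a *: x + y) = a * f x + f y) /\ continuous f.

Definition borel_meas (Omega : Type) (T : topologicalType)
  (G : set (set Omega)) (f : Omega -> T) : Prop :=
  forall O : set T, open O -> G (f @^-1` O).

Definition borel_sets (T : topologicalType) : set (set T) := <<s open >>.

Definition Trunc (B : normedModType R) (x : B) : R :=
  if x == 0 then 1 else Num.min 1 (`|x|)^-1.

Definition Kp (p : R) : R := p^-1 * ((p - 1) / p) `^ (p - 1).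

Definition Cfrak (B : normedModType R) (beta p : R) : R :=
  (if `[< is_hilbert B >] then 2 `^ (p - 1) else 2 `^ (p + 1)) *
  ((expR (2 / beta) - 2 / beta - 1) / (2 / beta) ^+ 2).

Definition Bfrak (B : normedModType R) (beta p : R) : R :=
  (2 `^ ((p - 1) / p) + 2 `^ (p^-1)) *
  (beta * Cfrak B beta p + Kp p * 2 `^ (p - 1)) `^ (p^-1).

Section Prob.
Context {d : measure_display} {Omega : measurableType d}.
Variable P : probability Omega R.

Definition filtration (F : nat -> set (set Omega)) : Prop :=
  (forall n, sigma_algebra setT (F n)) /\
  (forall n, F n `<=` measurable) /\
  (forall n, F n `<=` F n.+1).

(* E(Y | G) = mu for a B-valued Y (weak/Pettis formulation, which for
   Bochner-integrable Y in a separable Banach space characterises the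
   conditional expectation): ||Y|| is integrable and for every G-event A
   and every continuous linear functional f, E[f(Y) 1_A] = f(mu) P(A). *)
Definition cond_exp_eq (B : normedModType R) (G : set (set Omega))
  (Y : Omega -> B) (mu : B) : Prop :=
  P.-integrable setT (fun w => (`|Y w|)%:E) /\
  forall f : B -> R, clf f -> forall A, G A ->
    (\int[P]_(w in A) (f (Y w))%:E = (f mu)%:E * P A)%E.

(* E(Z | G) <= v a.s. for a nonnegative real Z:
   for every G-event A, E[Z 1_A] <= v P(A). *)
Definition cond_exp_le (G : set (set Omega)) (Z : Omega -> R) (v : R) : Prop :=
  forall A, G A -> (\int[P]_(w in A) (Z w)%:E <= v%:E * P A)%E.

End Prob.
End Defs.

Section Estimator.
Variable R : realType.
Variable B : normedModType R.
Variable Omega : Type.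

Definition Zj (Zhat : forall m : nat, {ptws 'I_m -> B} -> B) (k : nat -> nat)
  (X : nat -> Omega -> B) (j : nat) (w : Omega) : B :=
  Zhat (k j) (fun i : 'I_(k j) => X i.+1 w).

Definition deltaj (h : R -> R) (delta : R) (j : nat) : R := delta / h j%:R.

Definition Cpj (beta p v : R) (r : R -> nat -> R) (k : nat -> nat)
  (h : R -> R) (delta : R) (j : nat) : R :=
  (beta * Cfrak B beta p + 2 `^ (p - 1) * Kp p) *
  (v + r (deltaj h delta j / 2) (k j) `^ p).

Definition lamj (beta p v : R) (r : R -> nat -> R) (k : nat -> nat)
  (h : R -> R) (delta : R) (j : nat) : R :=
  (beta * ln (4 / deltaj h delta j) /
     (2 ^+ j * Cpj beta p v r k h delta j)) `^ p^-1.

Definition muhatj (Zhat : forall m : nat, {ptws 'I_m -> B} -> B)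
  (X : nat -> Omega -> B) (beta p v : R) (r : R -> nat -> R)
  (k : nat -> nat) (h : R -> R) (delta : R) (n j : nat) (w : Omega) : B :=
  let Z := Zj Zhat k X j w in
  let lam := lamj beta p v r k h delta j in
  (n%:R - (k j)%:R)^-1 *:
    \sum_((k j).+1 <= m < n.+1)
       (Trunc (lam *: (X m w - Z)) *: (X m w - Z) + Z).

Definition muhat (Zhat : forall m : nat, {ptws 'I_m -> B} -> B)
  (X : nat -> Omega -> B) (beta p v : R) (r : R -> nat -> R)
  (k : nat -> nat) (h : R -> R) (delta : R) (n : nat) (w : Omega) : B :=
  muhatj Zhat X beta p v r k h delta n (trunc_log 2 n) w.

End Estimator.

(* Main.v *)
(** Fix a dyadic level j. On the event ||Z_j - mu|| < r_j, the truncated and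
    recentred sums S_n make cosh ((lambda / beta) ||S_n||) e^{- kappa n} a
    supermartingale (Pinelis), so Ville's inequality bounds all of them at once;
    the choice of lambda_j balances the resulting deviation against the
    truncation bias, and a union bound over j concludes.

    The one-step estimate rests on the pointwise inequality
      cosh ||x + y|| <= cosh ||x|| + l(y)
                        + beta^2 (e^||y|| - 1 - ||y||) cosh ||x||
    with l bounded and linear, obtained from the derivative of ||.||^2, which
    beta-smoothness makes linear; the same derivative provides norming
    functionals. No conditional expectation of vectors is needed: the estimate
    is proved on every event A of the past with the past frozen to a constant,
    centring the truncated variable at its mean over A. *)

Require Import Defs.
From mathcomp Require Import all_boot all_order all_algebra.
From mathcomp Require Import all_classical all_reals all_analysis.
From mathcomp Require Import measurable_realfun ring lra.
Import Order.TTheory GRing.Theory Num.Theory.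
Import numFieldNormedType.Exports.
Local Open Scope classical_set_scope.
Local Open Scope ring_scope.

Set Implicit Arguments.
Unset Strict Implicit.
Unset Printing Implicit Defensive.

(** The function cosh is used because it is even: cosh of the norm depends only on ||.||^2, so the
    point 0, where the norm has no derivative, causes no trouble; and cosh u >= e^u / 2 turns a
    maximal bound into an exponential one at the cost of a factor 2. Truncated increments have norm
    at most 1/lambda, so centred and scaled by lambda/beta they have norm at most 2/beta: this is
    the argument 2/beta in [Cfrak], and the scaling cancels the beta^2 of the one-step inequality.
    Truncation moves the mean; the resulting bias b shifts the base point and enters the growth rate
    kappa through cosh(s||x + b||) <= e^{s||b||} cosh(s||x||). Half of delta_j is spent on Z_j and
    half on the maximal inequality; with the factor 2 lost to cosh this gives log(4/delta_j). One
    lambda_j serves a whole dyadic block, on which n - k(j) is within a factor 2 of 2^j; this yields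
    the two powers of 2 in [Bfrak]. The past is frozen only up to an error e, which costs a factor
    e^{5se} per step and disappears as e tends to 0. *)

Section SmoothNorm.
Context {R : realType} {B : normedModType R}.
Implicit Types x y z : B.

(** [clf] records continuity only, whereas the estimates need a norm bound; [clf] is recovered from
    it where the hypothesis on conditional means is applied. *)
Definition bounded_linear (f : B -> R) : Prop :=
  (forall (a : R) x y, f (a *: x + y) = a * f x + f y) /\
  exists C : R, forall x, `|f x| <= C * `|x|.

Lemma bounded_linear0 f : bounded_linear f -> f 0 = 0.
Proof.
by move=> [+ _] => /(_ (-1) 0 0); rewrite scaler0 addr0 mulN1r addNr.
Qed.

Lemma bounded_linearD f x y : bounded_linear f -> f (x + y) = f x + f y.
Proof. by move=> [+ _] => /(_ 1 x y); rewrite scale1r mul1r. Qed.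

Lemma bounded_linearZ f a x : bounded_linear f -> f (a *: x) = a * f x.
Proof.
by move=> bf; have [+ _] := bf => /(_ a x 0); rewrite bounded_linear0 // !addr0.
Qed.

Lemma bounded_linearB f x y : bounded_linear f -> f (x - y) = f x - f y.
Proof.
by move=> bf; rewrite bounded_linearD// -scaleN1r bounded_linearZ// mulN1r.
Qed.

Lemma bounded_linear_clf f : bounded_linear f -> clf f.
Proof.
move=> bf; have [lf [C fC]] := bf; split => // x.
have fC' y : `|f y| <= (`|C| + 1) * `|y|.
  by apply: (le_trans (fC y)); rewrite ler_wpM2r// ler_wpDr// ler_norm.
have C0 : 0 < `|C| + 1 by rewrite ltr_wpDl.
apply/cvgrPdist_lt => e e0; near=> y.
rewrite -bounded_linearB//; apply: (le_lt_trans (fC' _)).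
rewrite -ltr_pdivlMl//; near: y.
by apply: (@cvgr_dist_lt _ _ _ _ _ id); rewrite ?mulr_gt0 ?invr_gt0.
Unshelve. all: by end_near. Qed.

(** * The derivative of the squared norm under beta-smoothness *)

Lemma sqr_norm_convex (a b : R) x y : 0 <= a -> 0 <= b -> a + b = 1 ->
  `|a *: x + b *: y| ^+ 2 <= a * `|x| ^+ 2 + b * `|y| ^+ 2.
Proof.
move=> a0 b0 ab.
have h : `|a *: x + b *: y| <= a * `|x| + b * `|y|.
  by apply: (le_trans (ler_normD _ _)); rewrite !normrZ !ger0_norm.
apply: (@le_trans _ _ ((a * `|x| + b * `|y|) ^+ 2)).
  by rewrite lerXn2r// nnegrE// addr_ge0// mulr_ge0.
rewrite -subr_ge0.
have -> : b = 1 - a by rewrite -ab addrC addKr.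
set u := `|x|; set v := `|y|.
have -> : a * u ^+ 2 + (1 - a) * v ^+ 2 - (a * u + (1 - a) * v) ^+ 2 =
  (a * (1 - a)) * (u - v) ^+ 2 by ring.
rewrite mulr_ge0 ?sqr_ge0// mulr_ge0//.
by have -> : 1 - a = b by rewrite -ab addrC addKr.
Qed.

Definition sqr_norm_quotient x y (t : R) : R :=
  (`|x + t *: y| ^+ 2 - `|x| ^+ 2) / t.

(* Gateaux derivative of the convex function ||.||^2 at x, as an infimum of
   difference quotients. *)
Definition dsqr_norm x y : R :=
  inf [set sqr_norm_quotient x y t | t in [set t | 0 < t]].

Lemma sqr_norm_quotient_ge x y t : 0 < t ->
  - (2 * `|x| * `|y|) <= sqr_norm_quotient x y t.
Proof.
move=> t0; rewrite /sqr_norm_quotient ler_pdivlMr//.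
have h : `| `|x| - `|t *: y| | <= `|x + t *: y|.
  by have := ler_dist_dist x (- (t *: y)); rewrite normrN opprK.
have : (`|x| - `|t *: y|) ^+ 2 <= `|x + t *: y| ^+ 2.
  by rewrite -[leLHS]real_normK ?num_real// lerXn2r// nnegrE.
rewrite normrZ gtr0_norm//; set u := `|x|; set v := `|y|.
have := sqr_ge0 (t * v); lra.
Qed.

Lemma dsqr_norm_le x y t : 0 < t -> dsqr_norm x y <= sqr_norm_quotient x y t.
Proof.
move=> t0; apply: ge_inf; last by exists t.
(* The lower bound makes [inf] a genuine infimum rather than a default value. *)
by exists (- (2 * `|x| * `|y|)) => _ [s s0 <-]; exact: sqr_norm_quotient_ge.
Qed.

Lemma dsqr_norm_ge x y c :
  (forall t, 0 < t -> c <= sqr_norm_quotient x y t) -> c <= dsqr_norm x y.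
Proof.
move=> h; apply: lb_le_inf; first by exists (sqr_norm_quotient x y 1), 1 => /=.
by move=> _ [t t0 <-]; exact: h.
Qed.

(** The step st/(s+t) makes the point on the left a convex combination of x + sy and x + tz. Since s
    and t vary independently, the two infima can be taken separately, without monotonicity of the
    quotients. *)
Lemma sqr_norm_quotientD x y z s t : 0 < s -> 0 < t ->
  sqr_norm_quotient x (y + z) (s * t / (s + t)) <=
  sqr_norm_quotient x y s + sqr_norm_quotient x z t.
Proof.
move=> s0 t0; have st : 0 < s + t by rewrite addr_gt0.
have tau0 : 0 < s * t / (s + t) by rewrite divr_gt0// mulr_gt0.
rewrite {1}/sqr_norm_quotient ler_pdivrMr//.
have E : x + (s * t / (s + t)) *: (y + z) =
    (t / (s + t)) *: (x + s *: y) + (s / (s + t)) *: (x + t *: z).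
  rewrite !scalerDr !scalerA addrACA -scalerDl -mulrDl (addrC t s).
  rewrite divff ?gt_eqF// scale1r.
  by rewrite (_ : t / (s + t) * s = s * t / (s + t)); [
    rewrite (_ : s / (s + t) * t = s * t / (s + t))//; ring|ring].
have := @sqr_norm_convex (t / (s + t)) (s / (s + t)) (x + s *: y) (x + t *: z).
rewrite -E => /(_ _ _ _)/wrap[].
- by rewrite ltW// divr_gt0.
- by rewrite ltW// divr_gt0.
- by rewrite -mulrDl (addrC t) divff// gt_eqF.
move=> /le_trans h; rewrite lerBlDr; apply: h; rewrite le_eqVlt; apply/orP; left.
by apply/eqP; rewrite /sqr_norm_quotient; field; rewrite !gt_eqF.
Qed.

Lemma dsqr_normD_le x y z : dsqr_norm x (y + z) <= dsqr_norm x y + dsqr_norm x z.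
Proof.
rewrite -lerBlDr; apply: dsqr_norm_ge => s s0; rewrite lerBlDl -lerBlDr.
apply: dsqr_norm_ge => t t0; rewrite lerBlDl.
apply: le_trans (sqr_norm_quotientD _ _ _ s0 t0); apply: dsqr_norm_le.
by rewrite divr_gt0 ?mulr_gt0 ?addr_gt0.
Qed.

Lemma sqr_norm_quotient0 x t : sqr_norm_quotient x 0 t = 0.
Proof. by rewrite /sqr_norm_quotient scaler0 addr0 subrr mul0r. Qed.

Lemma dsqr_norm0 x : dsqr_norm x 0 = 0.
Proof.
apply/eqP; rewrite eq_le; apply/andP; split.
  by rewrite -(sqr_norm_quotient0 x 1); exact: dsqr_norm_le.
by apply: dsqr_norm_ge => t _; rewrite sqr_norm_quotient0.
Qed.

Lemma dsqr_norm_pZ_le x y c : 0 < c -> dsqr_norm x (c *: y) <= c * dsqr_norm x y.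
Proof.
move=> c0; rewrite -ler_pdivrMl//; apply: dsqr_norm_ge => t t0.
rewrite ler_pdivrMl//.
apply: (le_trans (dsqr_norm_le _ _ (divr_gt0 t0 c0))).
rewrite /sqr_norm_quotient scalerA divfK ?gt_eqF// invf_div.
by rewrite le_eqVlt; apply/orP; left; apply/eqP; field; rewrite !gt_eqF.
Qed.

Lemma dsqr_norm_self x : 2 * `|x| ^+ 2 <= dsqr_norm x x.
Proof.
apply: dsqr_norm_ge => t t0; rewrite /sqr_norm_quotient.
rewrite -{2}(scale1r x) -scalerDl normrZ gtr0_norm ?addr_gt0//.
rewrite ler_pdivlMr//; have := sqr_ge0 (t * `|x|); lra.
Qed.

Variable beta : R.
Hypothesis smoothB : beta_smooth B beta.

Let smooth x y : `|x + y| ^+ 2 + `|x - y| ^+ 2 <=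
  2 * `|x| ^+ 2 + 2 * beta ^+ 2 * `|y| ^+ 2.
Proof. by have [_ [_]] := smoothB; exact. Qed.

(** Smoothness makes the second difference O(t^2), so the quotients in the directions y and -y
    cancel up to O(t). This forces the sublinear map [dsqr_norm x] to be odd, hence linear. *)
Lemma sqr_norm_quotientN_le x y t : 0 < t ->
  sqr_norm_quotient x y t + sqr_norm_quotient x (- y) t <=
  t * (2 * beta ^+ 2 * `|y| ^+ 2).
Proof.
move=> t0; rewrite /sqr_norm_quotient -mulrDl ler_pdivrMr// scalerN.
have := smooth x (t *: y); rewrite normrZ gtr0_norm// exprMn; lra.
Qed.

Lemma le_of_le_eps (a b c : R) : 0 <= c ->
  (forall t, 0 < t -> a <= b + t * c) -> a <= b.
Proof.
move=> c0 h; apply/ler_addgt0Pr => e e0.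
have c1 : 0 < c + 1 by rewrite ltr_wpDl.
apply: (le_trans (h (e / (c + 1)) (divr_gt0 e0 c1))).
by rewrite lerD2l mulrAC ler_pdivrMr// ler_wpM2l ?ltW// ltrDl.
Qed.

Let bnd_ge0 y : 0 <= 2 * beta ^+ 2 * `|y| ^+ 2.
Proof. by rewrite mulr_ge0 ?sqr_ge0// mulr_ge0 ?sqr_ge0. Qed.

Lemma dsqr_normN x y : dsqr_norm x (- y) = - dsqr_norm x y.
Proof.
apply/eqP; rewrite eq_le; apply/andP; split; last first.
  by have := dsqr_normD_le x y (- y); rewrite subrr dsqr_norm0; lra.
apply: (le_of_le_eps (bnd_ge0 y)) => t t0.
have := sqr_norm_quotientN_le x y t0.
have := dsqr_norm_le x y t0; have := dsqr_norm_le x (- y) t0; lra.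
Qed.

Lemma dsqr_normD x y z : dsqr_norm x (y + z) = dsqr_norm x y + dsqr_norm x z.
Proof.
apply/eqP; rewrite eq_le dsqr_normD_le/=.
by have := dsqr_normD_le x (y + z) (- z); rewrite addrK dsqr_normN; lra.
Qed.

Lemma dsqr_normZ x c y : dsqr_norm x (c *: y) = c * dsqr_norm x y.
Proof.
have pZ a u : 0 < a -> dsqr_norm x (a *: u) = a * dsqr_norm x u.
  move=> a0; apply/eqP; rewrite eq_le dsqr_norm_pZ_le//=.
  rewrite -ler_pdivlMl//.
  have := @dsqr_norm_pZ_le x (a *: u) a^-1; rewrite invr_gt0 => /(_ a0).
  by rewrite scalerA mulVf ?gt_eqF// scale1r.
have [c0|c0|<-] := ltgtP 0 c; last by rewrite scale0r mul0r dsqr_norm0.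
  exact: pZ.
by rewrite -[c]opprK scaleNr dsqr_normN pZ ?oppr_gt0// !mulNr.
Qed.

Lemma dsqr_norm_bound x y : `|dsqr_norm x y| <= 2 * `|x| * `|y|.
Proof.
have lo u : - (2 * `|x| * `|u|) <= dsqr_norm x u.
  by apply: dsqr_norm_ge => t; exact: sqr_norm_quotient_ge.
by rewrite ler_norml lo/=; have := lo (- y); rewrite dsqr_normN normrN lerN2.
Qed.

Lemma dsqr_norm_bounded_linear x c : bounded_linear (fun y => c * dsqr_norm x y).
Proof.
split=> [a y z|]; first by rewrite dsqr_normD dsqr_normZ mulrDr mulrCA.
exists (`|c| * (2 * `|x|)) => y.
by rewrite normrM -mulrA ler_wpM2l// dsqr_norm_bound.
Qed.

(* t |-> |x + t y|^2 - beta^2 t^2 |y|^2 is midpoint concave, so its dyadic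
   difference quotients at 0 increase as t decreases. *)
Lemma sqr_norm_dyadic x y n :
  `|x + y| ^+ 2 - `|x| ^+ 2 - beta ^+ 2 * `|y| ^+ 2 <=
  sqr_norm_quotient x y (2 ^- n) - 2 ^- n * (beta ^+ 2 * `|y| ^+ 2).
Proof.
elim: n => [|n IH].
  by rewrite expr0 invr1 /sqr_norm_quotient divr1 scale1r mul1r.
apply: (le_trans IH); set t := 2 ^- n.
have -> : 2 ^- n.+1 = t / 2 :> R by rewrite /t exprS invfM mulrC.
have t0 : 0 < t by rewrite invr_gt0 exprn_gt0.
rewrite /sqr_norm_quotient invf_div.
have := smooth (x + (t / 2) *: y) ((t / 2) *: y).
rewrite addrK -addrA -scalerDl -splitr normrZ gtr0_norm ?divr_gt0// exprMn.
set u := `|x + t *: y| ^+ 2; set v := `|x + (t / 2) *: y| ^+ 2.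
set a := `|x| ^+ 2; set b := beta ^+ 2 * `|y| ^+ 2.
move=> h; have {}h : u + a <= 2 * v + 2 * (t / 2) ^+ 2 * b.
  by apply: (le_trans h); rewrite /b; lra.
rewrite -(ler_pM2r t0).
have -> : ((u - a) / t - t * b) * t = u - a - t ^+ 2 * b.
  by field; rewrite gt_eqF.
have -> : ((v - a) * (2 / t) - t / 2 * b) * t = 2 * (v - a) - t ^+ 2 / 2 * b.
  by field; rewrite gt_eqF.
by move: h; rewrite !exprMn; lra.
Qed.

Lemma sqr_norm_smooth x y :
  `|x + y| ^+ 2 <= `|x| ^+ 2 + dsqr_norm x y + beta ^+ 2 * `|y| ^+ 2.
Proof.
set D := dsqr_norm x y.
suff : `|x + y| ^+ 2 - `|x| ^+ 2 - beta ^+ 2 * `|y| ^+ 2 <= D by lra.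
apply/ler_addgt0Pr => e e0.
have b0 := bnd_ge0 y; set b := 2 * _ * _ in b0.
have [n nb] : exists n : nat, b / e < 2 ^+ n.
  exists (Num.bound (b / e)).
  apply: (lt_trans (archi_boundP (divr_ge0 b0 (ltW e0)))).
  by rewrite -natrX ltr_nat ltn_expl.
set t : R := 2 ^- n.
have t0 : 0 < t by rewrite invr_gt0 exprn_gt0.
have te : t * b <= e.
  by rewrite mulrC ler_pdivrMr ?exprn_gt0// mulrC -ler_pdivrMr// ltW.
apply: (le_trans (sqr_norm_dyadic _ _ n)); rewrite -/t.
(* The quotient exceeds the derivative by at most t b: the quotient in direction -y is at least its
   infimum, which is minus the derivative at y. *)
have := sqr_norm_quotientN_le x y t0; have := dsqr_norm_le x (- y) t0.
rewrite dsqr_normN -/D -/b.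
have : 0 <= t * (beta ^+ 2 * `|y| ^+ 2).
  by apply: mulr_ge0; [exact: ltW|apply: mulr_ge0; exact: sqr_ge0].
lra.
Qed.

(** The derivative of ||.||^2 at x has norm at most 2||x|| and takes a value of at least 2||x||^2 at
    x, whence the normalisation by 2||x||. This replaces Hahn-Banach. *)
Lemma norming_functional x : exists f : B -> R,
  [/\ bounded_linear f, f x = `|x| & forall y, `|f y| <= `|y|].
Proof.
have [->|x0] := eqVneq x 0.
  exists (fun=> 0); split; rewrite ?normr0//.
  split; first by move=> *; rewrite mulr0 addr0.
  by exists 0 => y; rewrite normr0 mul0r.
have nx : 0 < `|x| by rewrite normr_gt0.
have bnd y : `|(2 * `|x|)^-1 * dsqr_norm x y| <= `|y|.
  rewrite normrM gtr0_norm ?invr_gt0 ?mulr_gt0// ler_pdivrMl ?mulr_gt0//.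
  exact: dsqr_norm_bound.
exists (fun y => (2 * `|x|)^-1 * dsqr_norm x y); split => //.
  exact: dsqr_norm_bounded_linear.
apply/eqP; rewrite eq_le (le_trans (ler_norm _) (bnd x))/=.
rewrite ler_pdivlMl ?mulr_gt0// -mulrA -expr2; exact: dsqr_norm_self.
Qed.

(** Smoothness at the base point 0 reads 2||x||^2 <= 2 beta^2 ||x||^2, which is empty in the zero
    space. *)
Lemma beta_smooth_ge1 x : x != 0 -> 0 < beta -> 1 <= beta.
Proof.
move=> x0 b0; have := smooth 0 x; rewrite add0r sub0r normrN normr0.
have nx : 0 < `|x| ^+ 2 by rewrite exprn_gt0// normr_gt0.
rewrite expr0n/= mulr0 add0r => h.
have {}h : 1 <= beta ^+ 2 by rewrite -(ler_pM2r nx); lra.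
by rewrite -(@expr_ge1 _ 2)// ltW.
Qed.

End SmoothNorm.

(** * Calculus for cosh, sinh and the remainder e^u - 1 - u *)

Section HyperbolicCosine.
Context {R : realType}.
Implicit Types a b t u x z : R.

Definition cosh x : R := (expR x + expR (- x)) / 2.
Definition sinh x : R := (expR x - expR (- x)) / 2.

Lemma le_of_is_derive_ge0 (f df : R -> R) a b : a <= b ->
  (forall x, is_derive x 1 f (df x)) -> (forall x, a <= x <= b -> 0 <= df x) ->
  f a <= f b.
Proof.
move=> ab fdf df0.
have [|c /itvP cab E] := @MVT_segment _ f df a b ab (fun x _ => fdf x).
  apply: derivable_within_continuous => x _; by have [] := fdf x.
by rewrite -subr_ge0 E mulr_ge0 ?subr_ge0// df0// !cab.
Qed.

Global Instance is_derive_expRN x : is_derive x 1 (fun t => expR (- t)) (- expR (- x)).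
Proof.
have := @is_derive1_comp _ (@expR R) (@GRing.opp R) x (expR (- x)) (- 1).
by rewrite mulrN1; apply; exact: is_derive_expR.
Qed.

Global Instance is_derive_cosh x : is_derive x 1 cosh (sinh x).
Proof.
rewrite (_ : cosh = (2^-1 : R) \*: (expR + (fun t => expR (- t)))).
  by apply: is_derive_eq; rewrite /sinh mulrC.
by apply/funext => t; rewrite /cosh/= mulrC.
Qed.

Global Instance is_derive_sinh x : is_derive x 1 sinh (cosh x).
Proof.
rewrite (_ : sinh = (2^-1 : R) \*: (expR - (fun t => expR (- t)))).
  by apply: is_derive_eq; rewrite /cosh opprK mulrC.
by apply/funext => t; rewrite /sinh/= mulrC.
Qed.

Lemma continuous_cosh : continuous cosh.
Proof.
move=> x; apply: differentiable_continuous; apply/derivable1_diffP.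
by have [] := is_derive_cosh x.
Qed.

Lemma cosh0 : cosh 0 = 1.
Proof. by rewrite /cosh oppr0 expR0 -mulr2n -mulr_natr mul1r divff. Qed.

Lemma sinh0 : sinh 0 = 0. Proof. by rewrite /sinh oppr0 subrr mul0r. Qed.

Lemma coshN x : cosh (- x) = cosh x. Proof. by rewrite /cosh opprK addrC. Qed.

Lemma cosh_norm x : cosh `|x| = cosh x.
Proof. by have [x0|x0] := ger0P x; rewrite ?coshN. Qed.

Lemma cosh_gt0 x : 0 < cosh x.
Proof. by rewrite divr_gt0// addr_gt0// expR_gt0. Qed.

Lemma coshD x z : cosh (x + z) = cosh x * cosh z + sinh x * sinh z.
Proof. by rewrite /cosh /sinh opprD !expRD; field. Qed.

Lemma coshB x z : cosh (x - z) = cosh x * cosh z - sinh x * sinh z.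
Proof. by rewrite /cosh /sinh opprD !expRD opprK; field. Qed.

Lemma expR_cosh_sinh x : expR x = cosh x + sinh x.
Proof. by rewrite /cosh /sinh; field. Qed.

Lemma sinh_le_cosh x : sinh x <= cosh x.
Proof. by rewrite /sinh /cosh ler_wpM2r//; have := expR_ge0 (- x); lra. Qed.

Lemma half_expR_le_cosh x : expR x / 2 <= cosh x.
Proof. by rewrite /cosh ler_wpM2r//; have := expR_ge0 (- x); lra. Qed.

Lemma sinh_ge0 x : 0 <= x -> 0 <= sinh x.
Proof.
move=> x0; rewrite -sinh0; apply: (le_of_is_derive_ge0 x0) => t _.
exact/ltW/cosh_gt0.
Qed.

Lemma le_cosh x z : 0 <= x -> x <= z -> cosh x <= cosh z.
Proof.
move=> x0 xz; apply: (le_of_is_derive_ge0 xz) => t /andP[xt _].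
exact/sinh_ge0/(le_trans x0).
Qed.

Lemma cosh_ge1 x : 1 <= cosh x.
Proof. by rewrite -cosh0 -(cosh_norm x); exact: le_cosh. Qed.

Lemma coshD_le x z : 0 <= z -> cosh (x + z) <= expR z * cosh x.
Proof.
move=> z0; rewrite /cosh opprD !expRD mulrA ler_wpM2r//.
rewrite mulrDr lerD//; first by rewrite mulrC.
by rewrite mulrC ler_wpM2r ?expR_ge0// ler_expR; lra.
Qed.

Lemma sinh_ge x : 0 <= x -> x <= sinh x.
Proof.
move=> x0; pose f : R -> R := sinh - id.
have fE t : f t = sinh t - t by [].
have : f 0 <= f x.
  apply: (@le_of_is_derive_ge0 f (fun t => cosh t - 1)) => // t _.
  by rewrite subr_ge0 cosh_ge1.
by rewrite !fE sinh0; lra.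
Qed.

Lemma sinh_le_mul_cosh x : 0 <= x -> sinh x <= x * cosh x.
Proof.
move=> x0; pose f : R -> R := id * cosh - sinh.
have fE t : f t = t * cosh t - sinh t by [].
have : f 0 <= f x.
  apply: (@le_of_is_derive_ge0 f (fun t => t * sinh t)) => // t.
    by apply: is_derive_eq; rewrite /GRing.scale/=; ring.
  by move=> /andP[t0 _]; rewrite mulr_ge0// sinh_ge0.
by rewrite !fE sinh0; lra.
Qed.

(** Monotonicity of sinh t / t, cleared of denominators so that a = 0 is allowed. *)
Lemma sinh_ratio_le a t : 0 <= a -> a <= t -> t * sinh a <= a * sinh t.
Proof.
move=> a0 t_ge_a; pose f : R -> R := a \*: sinh - sinh a \*: id.
have fE z : f z = a * sinh z - sinh a * z by [].
have : f a <= f t.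
  apply: (@le_of_is_derive_ge0 f (fun t => a * cosh t - sinh a)) => // z.
    by apply: is_derive_eq; rewrite /GRing.scale/=; ring.
  move=> /andP[az _]; rewrite subr_ge0; apply: (le_trans (sinh_le_mul_cosh a0)).
  by rewrite ler_wpM2l// le_cosh.
by rewrite !fE; lra.
Qed.

Lemma expR_quad_ge u : 0 <= u -> u ^+ 2 / 2 <= expR u - 1 - u.
Proof.
move=> u0; pose f : R -> R := expR - id - (2^-1 : R) \*: (id * id).
have fE t : f t = expR t - t - 2^-1 * t ^+ 2 by [].
have : f 0 <= f u.
  apply: (@le_of_is_derive_ge0 f (fun t => expR t - 1 - t)) => // t.
    by apply: is_derive_eq; rewrite /GRing.scale/=; field.
  by have := expR_ge1Dx t; lra.
by rewrite !fE expR0; lra.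
Qed.

(** From order 2 on, each term of the series of e^{tM} carries at least t^2, so it is at most t^2
    times the same term for e^M; the comparison is made on partial sums. It amounts to monotonicity
    of (e^u - 1 - u)/u^2. *)
Lemma expR_taylor2_scale M t : 0 <= M -> 0 <= t -> t <= 1 ->
  expR (t * M) - 1 - t * M <= t ^+ 2 * (expR M - 1 - M).
Proof.
move=> M0 t0 t1.
have partial n : series (exp_coeff (t * M)) n.+2 <=
    1 + t * M + t ^+ 2 * (series (exp_coeff M) n.+2 - 1 - M).
  elim: n => [|n IH].
    by rewrite /series/= !big_nat_recr//= !big_nil /exp_coeff/= !expr0 !expr1
      !fact0 !divr1; lra.
  rewrite seriesSr [series _ n.+3]seriesSr.
  have : exp_coeff (t * M) n.+2 <= t ^+ 2 * exp_coeff M n.+2.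
    rewrite /exp_coeff/= mulrA ler_wpM2r ?invr_ge0// exprMn ler_wpM2r ?exprn_ge0//.
    by rewrite ler_wiXn2l.
  move: IH; lra.
have le_expR n : series (exp_coeff M) n <= expR M.
  apply: nondecreasing_cvgn_le; last exact: is_cvg_series_exp_coeff.
  apply/nondecreasing_seqP => m; rewrite [leRHS]seriesSr lerDl.
  exact: exp_coeff_ge0.
suff : expR (t * M) <= 1 + t * M + t ^+ 2 * (expR M - 1 - M) by lra.
apply: limr_le; first exact: is_cvg_series_exp_coeff.
near=> n.
have [m ->] : exists m, n = m.+2.
  by exists n.-2; rewrite -[LHS](@subnK 2) ?addn2 ?subn2//; near: n; exists 2.
apply: (le_trans (partial m)); rewrite lerD2l ler_wpM2l ?sqr_ge0//.
by have := le_expR m.+2; lra.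
Unshelve. all: by end_near. Qed.

Lemma expR_taylor2_le M u : 0 < M -> 0 <= u -> u <= M ->
  expR u - 1 - u <= (expR M - M - 1) / M ^+ 2 * u ^+ 2.
Proof.
move=> M0 u0 uM; have uMM : u / M * M = u by rewrite divfK ?gt_eqF.
have := @expR_taylor2_scale M (u / M) (ltW M0).
rewrite uMM divr_ge0 ?(ltW M0)// ler_pdivrMr// mul1r => /(_ isT uM) h.
apply: (le_trans h); rewrite le_eqVlt; apply/orP; left; apply/eqP.
by field; rewrite gt_eqF.
Qed.

(* cosh z - (sinh a / (2 a)) z^2 decreases for z <= a and
   increases for z >= a, so only z = |a - b| and z = a + b matter. *)
Lemma cosh_triangle_le a b z : 0 < a -> 0 <= b -> 0 <= z ->
  `|a - b| <= z -> z <= a + b ->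
  cosh z <= cosh a + sinh a / (2 * a) * (z ^+ 2 - a ^+ 2 - b ^+ 2) +
            (expR b - 1 - b) * cosh a.
Proof.
move=> a0 b0 z0 abz zab; set c := sinh a / (2 * a).
have c2 : 2 * c * a = sinh a by rewrite /c; field; rewrite gt_eqF.
have c2b : 2 * c * a * b = sinh a * b by rewrite c2.
pose hf : R -> R := cosh - c \*: (id * id).
have hfE t : hf t = cosh t - c * t ^+ 2 by [].
have dhf t : is_derive t 1 hf (sinh t - 2 * c * t).
  apply: is_derive_eq; rewrite /GRing.scale/=; ring.
have sb := sinh_ge b0; have sc := sinh_le_cosh a; have sa := sinh_ge0 (ltW a0).
have ca := cosh_gt0 a.
rewrite (expR_cosh_sinh b).
have [za|az] := leP z a.
  have : - hf `|a - b| <= - hf z.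
    apply: (@le_of_is_derive_ge0 (- hf) (fun t => - (sinh t - 2 * c * t))) => // t.
    move=> /andP[abt tz]; have t0 : 0 <= t by rewrite (le_trans _ abt).
    have := sinh_ratio_le t0 (le_trans tz za).
    by rewrite -(pmulr_rge0 _ a0) -c2; lra.
  rewrite !hfE cosh_norm real_normK ?num_real// coshB.
  (* At z = |a - b| the slack of the claim is exactly this product; at z = a + b it is the one with
     cosh a - sinh a. *)
  have : 0 <= (sinh b - b) * (cosh a + sinh a).
    by rewrite mulr_ge0//; lra.
  lra.
have : hf z <= hf (a + b).
  apply: (@le_of_is_derive_ge0 hf (fun t => (sinh t - 2 * c * t))) => // t.
  move=> /andP[zt tab]; have := sinh_ratio_le (ltW a0) (le_trans (ltW az) zt).
  by rewrite -(pmulr_rge0 _ a0) -c2; lra.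
rewrite !hfE coshD.
have : 0 <= (sinh b - b) * (cosh a - sinh a) by rewrite mulr_ge0//; lra.
lra.
Qed.

End HyperbolicCosine.

(** * The pointwise one-step inequality for cosh of the norm *)

Section CoshStep.
Context {R : realType} {B : normedModType R}.
Variable beta : R.
Hypothesis smoothB : beta_smooth B beta.
Hypothesis beta1 : 1 <= beta.

Lemma cosh_norm_smooth (x : B) : exists2 f : B -> R, bounded_linear f &
  forall y, cosh `|x + y| <=
    cosh `|x| + f y + beta ^+ 2 * (expR `|y| - 1 - `|y|) * cosh `|x|.
Proof.
have b1 : 0 <= beta ^+ 2 - 1 by rewrite subr_ge0 expr_ge1// (le_trans ler01).
have [->|x0] := eqVneq x 0.
  (* No linear term is needed at 0: cosh b = e^b - sinh b <= e^b - b. *)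
  exists (fun y => 0 * dsqr_norm x y).
    exact: dsqr_norm_bounded_linear smoothB _ _.
  move=> y; rewrite add0r normr0 cosh0 mul0r addr0 mulr1.
  have ge0 : 0 <= (beta ^+ 2 - 1) * (expR `|y| - 1 - `|y|).
    by rewrite mulr_ge0//; have := expR_ge1Dx `|y|; lra.
  have := sinh_ge (normr_ge0 y); move: ge0; rewrite expR_cosh_sinh; lra.
set a := `|x|; have a0 : 0 < a by rewrite normr_gt0.
pose c := sinh a / (2 * a).
have c0 : 0 <= c by rewrite divr_ge0 ?sinh_ge0 ?mulr_ge0 ?(ltW a0).
have ca : 2 * c <= cosh a.
  have -> : 2 * c = sinh a / a by rewrite /c; field; rewrite gt_eqF.
  rewrite ler_pdivrMr//.
  by rewrite [leRHS]mulrC; exact/sinh_le_mul_cosh/ltW.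
exists (fun y => c * dsqr_norm x y).
  exact: dsqr_norm_bounded_linear smoothB _ _.
move=> y; set b := `|y|; set z := `|x + y|.
have abz : `|a - b| <= z.
  by have := ler_dist_dist x (- y); rewrite normrN opprK.
have := cosh_triangle_le a0 (normr_ge0 y) (normr_ge0 _) abz (ler_normD _ _).
rewrite -/b -/z -/c.
have := sqr_norm_smooth smoothB x y; rewrite -/a -/b -/z => h.
have {}h : c * (z ^+ 2) <= c * (a ^+ 2 + dsqr_norm x y + beta ^+ 2 * b ^+ 2).
  by rewrite ler_wpM2l.
(* Smoothness leaves an excess (beta^2 - 1) c b^2 over the scalar inequality; it is absorbed since
   2c <= cosh a and b^2/2 <= e^b - 1 - b. *)
have : (beta ^+ 2 - 1) * (c * b ^+ 2) <=
    (beta ^+ 2 - 1) * ((expR b - 1 - b) * cosh a).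
  rewrite ler_wpM2l//.
  apply: (@le_trans _ _ (b ^+ 2 / 2 * cosh a)).
    have := sqr_ge0 b => b2; have := ler_wpM2l b2 ca; lra.
  by rewrite ler_wpM2r ?(ltW (cosh_gt0 a))// expR_quad_ge// normr_ge0.
move: h; lra.
Qed.

End CoshStep.

(** * Truncation: size, Lipschitz bound and bias *)

Section Truncation.
Context {R : realType} {B : normedModType R}.
Implicit Types (x y : B) (lam p u : R).

(** For lam > 0 this is the radial retraction onto the closed ball of radius 1/lam. *)
Definition clip lam y : B := Trunc (lam *: y) *: y.

Lemma TruncE lam y : 0 < lam ->
  Trunc (lam *: y) = (Num.max 1 (lam * `|y|))^-1.
Proof.
move=> l0; rewrite /Trunc normrZ (gtr0_norm l0).
have [->|y0] := eqVneq y 0.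
  by rewrite scaler0 eqxx normr0 mulr0 max_l ?invr1.
rewrite scaler_eq0 gt_eqF//= (negbTE y0).
have u0 : 0 < lam * `|y| by rewrite mulr_gt0 ?normr_gt0.
have [h|h] := leP 1 (lam * `|y|).
  by rewrite min_r// invf_le1.
by rewrite min_l ?invr1// ltW// invf_gt1.
Qed.

Lemma max1_gt0 u : 0 < Num.max 1 u.
Proof. by rewrite lt_max ltr01. Qed.

Lemma norm_clip lam y : 0 < lam ->
  `|clip lam y| = `|y| / Num.max 1 (lam * `|y|).
Proof.
move=> l0; rewrite /clip normrZ TruncE// gtr0_norm ?invr_gt0 ?max1_gt0//.
by rewrite mulrC.
Qed.

Lemma norm_clip_le lam y : 0 < lam -> `|clip lam y| <= lam^-1.
Proof.
move=> l0; rewrite norm_clip// ler_pdivrMr ?max1_gt0// ler_pdivlMl//.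
by rewrite le_max lexx orbT.
Qed.

(** One unit of the constant comes from moving the vector, the other from the change of the factor.
    The bound serves both measurability and the replacement of Z by a nearby constant. *)
Lemma clip_lipschitz lam x y : 0 < lam ->
  `|clip lam x - clip lam y| <= 2 * `|x - y|.
Proof.
move=> l0; rewrite /clip !TruncE//.
set u := lam * `|x|; set v := lam * `|y|.
set m := Num.max 1 u; set n := Num.max 1 v.
have m0 : 0 < m := max1_gt0 u; have n0 : 0 < n := max1_gt0 v.
have m1 : 1 <= m by rewrite le_max lexx.
have vn : v <= n by rewrite le_max lexx orbT.
have -> : m^-1 *: x - n^-1 *: y = m^-1 *: (x - y) + (m^-1 - n^-1) *: y.
  by rewrite scalerBr scalerBl addrA subrK.
apply: (le_trans (ler_normD _ _)); rewrite [leRHS]mulrC mulrDr !mulr1 lerD//.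
  rewrite normrZ gtr0_norm ?invr_gt0// ler_piMl//.
  by rewrite invf_le1.
rewrite normrZ.
have -> : m^-1 - n^-1 = (n - m) / (m * n) by field; rewrite !gt_eqF.
have mn : `|n - m| <= lam * `|x - y|.
  apply: (@le_trans _ _ `|v - u|).
    rewrite /n /m /u /v !maxEle; case: (leP 1 (lam * `|y|)) => hv;
      case: (leP 1 (lam * `|x|)) => hu; rewrite ?subrr ?normr0//.
      by rewrite !ger0_norm ?subr_ge0//; lra.
    by rewrite !ler0_norm ?subr_le0//; lra.
  rewrite -mulrBr normrM (gtr0_norm l0) ler_pM2l// distrC.
  exact: ler_dist_dist.
rewrite normrM normfV (gtr0_norm (mulr_gt0 m0 n0)) mulrAC ler_pdivrMr ?mulr_gt0//.
apply: (@le_trans _ _ (`|x - y| * v)).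
  by rewrite /v mulrCA mulrA ler_wpM2r.
rewrite ler_wpM2l//; apply: (le_trans vn); by rewrite ler_peMl// ltW.
Qed.

(** With u = lam ||y|| the left side is min(1, u)^2: for u < 1 the claim rests on p <= 2, for u >= 1
    on p >= 0. *)
Lemma sqr_clip_le lam p y : 0 < lam -> 1 < p <= 2 ->
  (lam * `|clip lam y|) ^+ 2 <= (lam * `|y|) `^ p.
Proof.
move=> l0 /andP[p1 p2]; rewrite norm_clip// mulrA; set u := lam * `|y|.
have u0 : 0 <= u by rewrite mulr_ge0// ltW.
have [h|h] := leP 1 u.
  rewrite divff ?expr1n ?gt_eqF ?(lt_le_trans ltr01)//.
  by rewrite -(powRr0 u) ler_powR//; lra.
rewrite divr1; have [->|un0] := eqVneq u 0; first by rewrite expr0n powR_ge0.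
rewrite -powR_mulrn//; apply: ger_powR => //.
by rewrite (ltW h) andbT lt_neqAle eq_sym un0.
Qed.

Lemma Kp_gt0 p : 1 < p -> 0 < Kp p.
Proof.
by move=> p1; rewrite /Kp mulr_gt0 ?invr_gt0 ?powR_gt0 ?divr_gt0//; lra.
Qed.

(** Young's inequality for u = (u/y) y, with y = q^{1/q} chosen so that the term y^q/q equals 1; the
    other term is then exactly Kp u^p. *)
Lemma le_Kp_powR p u : 1 < p -> 0 <= u -> u - 1 <= Kp p * u `^ p.
Proof.
move=> p1 u0; have p0 : 0 < p by lra.
have p10 : 0 < p - 1 by lra.
pose q := p / (p - 1); have q0 : 0 < q by rewrite divr_gt0.
have pq : p^-1 + q^-1 = 1 by rewrite /q; field; rewrite !gt_eqF.
pose y := q `^ q^-1; have y0 : 0 < y by rewrite powR_gt0.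
have := @conjugate_powR _ (u / y) y p q _ (ltW y0) p0 q0 pq.
rewrite divr_ge0 ?(ltW y0)// divfK ?gt_eqF// => /(_ isT).
rewrite {2}/y -powRrM mulVf ?gt_eqF// powRr1 ?(ltW q0)// divff ?gt_eqF//.
suff -> : (u / y) `^ p / p = Kp p * u `^ p by lra.
rewrite powRM ?invr_ge0 ?(ltW y0)//.
suff -> : y^-1 `^ p = ((p - 1) / p) `^ (p - 1) by rewrite /Kp; ring.
rewrite /y -powRN -powRrM -invf_div -/q.
rewrite -[in RHS](powR_inv1 (ltW q0)) -powRrM; congr (_ `^ _).
by rewrite /q; field; rewrite !gt_eqF.
Qed.

Lemma clip_bias lam p y : 0 < lam -> 1 < p ->
  lam * `|clip lam y - y| <= Kp p * (lam * `|y|) `^ p.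
Proof.
move=> l0 p1; rewrite /clip TruncE//; set u := lam * `|y|.
have u0 : 0 <= u by rewrite mulr_ge0// ltW.
rewrite -{2}(scale1r y) -scalerBl normrZ mulrCA -/u.
have [h|h] := leP 1 u; last first.
  by rewrite invr1 subrr normr0 mul0r mulr_ge0 ?powR_ge0// ltW// Kp_gt0.
have up : 0 < u by lra.
rewrite ler0_norm ?subr_le0 ?invf_le1// mulrC mulrN mulrBr divff ?gt_eqF//.
by apply: le_trans (le_Kp_powR p1 u0); lra.
Qed.

Lemma powR_normD_le p x y : 1 <= p ->
  `|x + y| `^ p <= 2 `^ (p - 1) * (`|x| `^ p + `|y| `^ p).
Proof.
move=> p1; have half : 2^-1 = 1 - 2^-1 :> R by lra.
apply: (@le_trans _ _ ((2^-1 * (2 * `|x|) + 2^-1 * (2 * `|y|)) `^ p)).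
  rewrite ge0_ler_powR ?nnegrE ?(le_trans _ p1)//.
  by rewrite !mulrA mulVf// !mul1r ler_normD.
apply: (@le_trans _ _ (2^-1 * (2 * `|x|) `^ p + 2^-1 * (2 * `|y|) `^ p)).
  rewrite {2 4}half.
  by apply: (convex_powR p1 (Itv01 _ _)) => //=;
    rewrite ?inE/= ?in_itv/= ?mulr_ge0// ?invr_ge0// invf_le1 ?ler1n.
rewrite !powRM// !mulrA -powR_inv1// -powRD ?pnatr_eq0 ?implybT//.
by rewrite (addrC _ p) -mulrDr.
Qed.

End Truncation.

(** * Sigma-algebras as families of sets, and Borel maps with respect to them *)

Section SigmaAlgebra.
Context {T : Type} (G : set (set T)).
Hypothesis sG : sigma_algebra setT G.

Lemma sigma_set0 : G set0. Proof. by case: sG. Qed.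

Lemma sigma_setC A : G A -> G (~` A).
Proof. by case: sG => _ + _ => /[apply]; rewrite setTD. Qed.

Lemma sigma_setT : G setT.
Proof. by rewrite -setC0; apply: sigma_setC; exact: sigma_set0. Qed.

Lemma sigma_bigcup (I : countType) (A : I -> set T) :
  (forall i, G (A i)) -> G (\bigcup_i A i).
Proof.
move=> GA.
rewrite (_ : \bigcup_i A i =
  \bigcup_n (if @choice.unpickle I n is Some i then A i else set0)); last first.
  apply/seteqP; split=> x [i _ Ax]; last first.
    by move: Ax; case: choice.unpickle => // j Ax; exists j.
  by exists (choice.pickle i); rewrite //= choice.pickleK.
case: sG => _ _; apply => n; case: choice.unpickle => //; exact: sigma_set0.
Qed.

Lemma sigma_bigcap (I : countType) (A : I -> set T) :
  (forall i, G (A i)) -> G (\bigcap_i A i).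
Proof.
move=> GA; rewrite -[X in G X]setCK setC_bigcap.
by apply/sigma_setC/sigma_bigcup => i; exact/sigma_setC.
Qed.

Lemma sigma_setU A1 A2 : G A1 -> G A2 -> G (A1 `|` A2).
Proof.
move=> G1 G2; rewrite (_ : _ `|` _ = \bigcup_(b : bool) (if b then A1 else A2)).
  by apply: sigma_bigcup => -[].
apply/seteqP; split=> x; first by case=> h; [exists true|exists false].
by move=> [[] _ h]; [left|right].
Qed.

Lemma sigma_setI A1 A2 : G A1 -> G A2 -> G (A1 `&` A2).
Proof.
move=> G1 G2; rewrite -[X in G X]setCK setCI.
by apply/sigma_setC/sigma_setU; exact: sigma_setC.
Qed.

Lemma sigma_setD A1 A2 : G A1 -> G A2 -> G (A1 `\` A2).
Proof. by move=> G1 G2; rewrite setDE; apply/sigma_setI/sigma_setC. Qed.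

End SigmaAlgebra.

Section BorelMaps.
Context {R : realType} {B : normedModType R} {Omega : Type}.
Variable G : set (set Omega).
Hypothesis sG : sigma_algebra setT G.

Lemma borel_meas_cst (T : topologicalType) (c : T) :
  borel_meas G (fun=> c : T).
Proof.
move=> O _; rewrite [X in G X](@preimage_cst T Omega c O).
by case: ifP => _; [exact: sigma_setT|exact: sigma_set0].
Qed.

Lemma borel_meas_comp (S T : topologicalType) (f : S -> T) (Y : Omega -> S) :
  continuous f -> borel_meas G Y -> borel_meas G (f \o Y).
Proof.
by move=> /continuousP cf bY O oO; rewrite comp_preimage; apply/bY/cf.
Qed.

Lemma borel_meas_ball (Y : Omega -> B) x (e : R) : borel_meas G Y ->
  G [set w | `|Y w - x| < e].
Proof.
move=> bY; rewrite (_ : mkset _ = Y @^-1` [set y | `|y - x| < e]) //.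
apply: bY; rewrite (_ : mkset _ = (fun y => `|y - x|) @^-1` [set r | r < e])//.
apply: open_comp => [y _|]; last exact: open_lt.
by apply: cvg_norm; apply: cvgB; [exact: cvg_id|exact: cvg_cst].
Qed.

Lemma separable_dense_seq : separable B ->
  exists x_ : nat -> B, forall y (e : R), 0 < e -> exists n, `|y - x_ n| < e.
Proof.
move=> [D [cD dD]].
have hit y (e : R) : 0 < e -> exists2 x, D x & `|y - x| < e.
  move=> e0; have [|x [yx Dx]] := dD (ball y e) _ (ball_open y e).
    by exists y; exact: ballxx.
  by exists x => //; move: yx; rewrite -ball_normE.
move/pfcard_geP: cD => [D0|[f]].
  by have [x] := hit 0 1 ltr01; rewrite D0.
exists (f : nat -> B) => y e e0; have [x Dx yx] := hit y e e0.
have [n _ fn] := @surj _ _ _ _ f x Dx.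
by exists n; rewrite fn.
Qed.

Hypothesis sepB : separable B.

(* Boxes of radius 1/(n+1) centred at a dense sequence form a countable base. *)
Lemma borel_meas_finite_family (I : finType) (Y : I -> Omega -> B)
  (O : set (I -> B)) :
  (forall i, borel_meas G (Y i)) ->
  (forall y, O y -> exists2 e : R, 0 < e &
     forall y', (forall i, `|y i - y' i| < e) -> O y') ->
  G [set w | O (fun i => Y i w)].
Proof.
move=> bY openO; have [x_ dense_x] := separable_dense_seq sepB.
pose box (q : nat * {ffun I -> nat}) : set (I -> B) :=
  [set y | forall i, `|y i - x_ (q.2 i)| < q.1.+1%:R^-1].
rewrite (_ : [set w | _] = \bigcup_q (if `[< box q `<=` O >] then
    \bigcap_i [set w | `|Y i w - x_ (q.2 i)| < q.1.+1%:R^-1] else set0)).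
  apply: sigma_bigcup => // q; case: ifP => _; last exact: sigma_set0.
  by apply: sigma_bigcap => // i; exact: borel_meas_ball.
apply/seteqP; split=> w /=; last first.
  move=> [q _]; case: asboolP => // qO h; apply: qO => i; exact: h.
move=> /openO[e e0 eO].
have [n ne] : exists n, n.+1%:R^-1 < e / 2.
  have [n _ h] := near_infty_natSinv_lt (PosNum (divr_gt0 e0 (ltr0n R 2))).
  by exists n; exact: (h n (leqnn n)).
have n0 : 0 < (n.+1%:R : R)^-1 by rewrite invr_gt0.
have /choice[g gP] i := dense_x (Y i w) _ n0.
exists (n, [ffun i => g i]) => //; case: asboolP => [_ i _|nO]; first by rewrite /= ffunE.
exfalso; apply: nO => y yb; apply: eO => i.
have := yb i; rewrite /= ffunE => h; have := gP i => h'.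
rewrite -(subrK (x_ (g i)) (Y i w)) -addrA.
apply: (le_lt_trans (ler_normD _ _)); rewrite [`|x_ _ - _|]distrC.
by rewrite [e]splitr; apply: ltrD; [exact: lt_trans ne|exact: lt_trans ne].
Qed.

(** Separability is what makes sums and other functions of two Borel variables Borel. The pair is
    treated as a family indexed by [bool], which avoids a product space. *)
Lemma borel_meas_lipschitz2 (V : normedModType R) (phi : B -> B -> V) (C : R)
  (Y Z : Omega -> B) :
  (forall x y x' y', `|phi x y - phi x' y'| <= C * (`|x - x'| + `|y - y'|)) ->
  borel_meas G Y -> borel_meas G Z -> borel_meas G (fun w => phi (Y w) (Z w)).
Proof.
move=> lip bY bZ O oO.
pose W (b : bool) := if b then Y else Z.
apply: (@borel_meas_finite_family _ W (fun y => O (phi (y true) (y false)))).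
  by case.
move=> y Oy; have /nbhs_ballP[e /= e0 eO] := open_nbhs_nbhs (conj oO Oy).
have C0 : 0 < `|C| + 1 by rewrite ltr_wpDl.
exists (e / (`|C| + 1) / 2); first by rewrite !divr_gt0.
move=> y' yy'; apply: eO; rewrite -ball_normE /ball_/=.
apply: (le_lt_trans (lip _ _ _ _)).
have h : `|y true - y' true| + `|y false - y' false| < e / (`|C| + 1).
  by rewrite [ltRHS]splitr ltrD.
apply: (@le_lt_trans _ _ ((`|C| + 1) * (`|y true - y' true| + `|y false - y' false|))).
  by rewrite ler_wpM2r ?addr_ge0// ler_wpDr// ler_norm.
by rewrite mulrC -ltr_pdivlMr.
Qed.

(** Otherwise there would be points outside O at uniform distance below 1/(n+1) from y, and they
    would converge pointwise to y. This supplies the radius that [borel_meas_finite_family] asks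
    for. *)
Lemma open_ptws_uniform m (O : set {ptws 'I_m -> B}) y : open O -> O y ->
  exists2 e : R, 0 < e & forall y', (forall i, `|y i - y' i| < e) -> O y'.
Proof.
move=> oO Oy; apply: contrapT => no.
have /choice[u uP] n : exists y', (forall i, `|y i - y' i| < (n.+1%:R : R)^-1) /\ ~ O y'.
  apply: contrapT => h; apply: no; exists n.+1%:R^-1; rewrite ?invr_gt0// => y' yy'.
  by apply: contrapT => nO; apply: h; exists y'.
have : {ptws, u @ \oo --> y}.
  apply/(@pointwise_cvgP (discrete_topology 'I_m)) => i.
  apply/cvgrPdist_lt => e e0.
  have [N _ hN] := near_infty_natSinv_lt (PosNum e0).
  by exists N => // n /hN; have [/(_ i) h _] := uP n; exact: lt_trans h.
move=> /(_ O (open_nbhs_nbhs (conj oO Oy)))[N _ /(_ N (leqnn N))].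
by have [_] := uP N.
Qed.

Lemma borel_meas_borel (S T : topologicalType) (f : S -> T) (Y : Omega -> S) :
  borel_meas (@borel_sets S) f -> borel_meas G Y -> borel_meas G (f \o Y).
Proof.
move=> bf bY O /bf; rewrite comp_preimage.
(* Good sets: H is a sigma-algebra containing the open sets, hence all Borel sets. *)
pose H := [set A : set S | G (Y @^-1` A)].
have sH : sigma_algebra setT H.
  split; rewrite /H /=.
  - by rewrite preimage_set0; exact: sigma_set0.
  - by move=> A GA; rewrite setTD preimage_setC; exact: sigma_setC.
  - by move=> A GA; rewrite preimage_bigcup; exact: sigma_bigcup.
move=> h; exact: (h H (conj sH bY)).
Qed.

Lemma borel_meas_estimator m (f : {ptws 'I_m -> B} -> B) (Y : 'I_m -> Omega -> B) :
  borel_meas (@borel_sets {ptws 'I_m -> B}) f -> (forall i, borel_meas G (Y i)) ->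
  borel_meas G (fun w => f (fun i => Y i w)).
Proof.
move=> bf bY; apply: (@borel_meas_borel {ptws 'I_m -> B} B f (fun w i => Y i w) bf) => O oO.
by apply: borel_meas_finite_family => // y; exact: open_ptws_uniform.
Qed.

End BorelMaps.

Lemma borel_measS {Omega : Type} (T : topologicalType) (G H : set (set Omega))
  (Y : Omega -> T) : G `<=` H -> borel_meas G Y -> borel_meas H Y.
Proof. by move=> GH bY O /bY /GH. Qed.

Lemma borel_meas_measurable_fun {R : realType} {d} {Omega : measurableType d}
  (f : Omega -> R) : borel_meas measurable f -> measurable_fun setT f.
Proof.
move=> bf mT; apply: (measurability _ (RGenOInfty.measurableE R)) => //.
move=> /= _ [_ [x ->] <-]; rewrite setTI; apply: bf; exact: interval_open.
Qed.

(** * Real integrals over events *)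

Section BoundedIntegrals.
Context {R : realType} {d : measure_display} {Omega : measurableType d}.
Variable P : probability Omega R.
Implicit Types (A : set Omega) (g : Omega -> R) (c : R).

Lemma integrable_bounded A g c : measurable A -> measurable_fun setT g ->
  (forall w, `|g w| <= c) -> P.-integrable A (EFin \o g).
Proof.
move=> mA mg gc; apply: measurable_bounded_integrable => //.
- by rewrite (le_lt_trans (probability_le1 P mA))// ltry.
- exact: measurable_funTS.
- by exists c; split; [exact: num_real|move=> y cy w _ /=; exact/(le_trans (gc w))/ltW].
Qed.

Lemma Rintegral_le_cst A g c : measurable A -> P.-integrable A (EFin \o g) ->
  (forall w, A w -> `|g w| <= c) ->
  `|\int[P]_(w in A) g w| <= c * fine (P A).
Proof.
move=> mA ig gc; apply: (le_trans (le_normr_Rintegral mA ig)).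
rewrite -Rintegral_cst//; apply: le_Rintegral => //.
  exact: (integrable_norm ig).
exact: finite_measure_integrable_cst.
Qed.

Lemma integrable_realZ A g c : measurable A -> P.-integrable A (EFin \o g) ->
  P.-integrable A (EFin \o (fun w => c * g w)).
Proof. by move=> mA ig; exact: (integrableZl mA c ig). Qed.

Lemma integrable_realD A g1 g2 : measurable A -> P.-integrable A (EFin \o g1) ->
  P.-integrable A (EFin \o g2) -> P.-integrable A (EFin \o (fun w => g1 w + g2 w)).
Proof. by move=> mA i1 i2; exact: (integrableD mA i1 i2). Qed.

Lemma integrable_realB A g1 g2 : measurable A -> P.-integrable A (EFin \o g1) ->
  P.-integrable A (EFin \o g2) -> P.-integrable A (EFin \o (fun w => g1 w - g2 w)).
Proof. by move=> mA i1 i2; exact: (integrableB mA i1 i2). Qed.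

Lemma integrable_realC A c : measurable A -> P.-integrable A (EFin \o (fun=> c)).
Proof. exact: finite_measure_integrable_cst. Qed.

Lemma fine_prob_ge0 A : 0 <= fine (P A).
Proof. by rewrite fine_ge0. Qed.

Lemma fine_probK A : measurable A -> (fine (P A))%:E = P A.
Proof. by move=> mA; rewrite fineK// fin_num_measure. Qed.

Lemma fine_prob_splitI A E : measurable A -> measurable E ->
  fine (P A) = fine (P (A `&` E)) + fine (P (A `\` E)).
Proof.
move=> mA mE; rewrite -fineD ?fin_num_measure//; last 2 first.
- exact: measurableI.
- exact: measurableD.
by rewrite [in LHS](measureDI P mA mE) addeC.
Qed.

Lemma Rintegral_splitI A E g : measurable A -> measurable E ->
  P.-integrable A (EFin \o g) ->
  \int[P]_(w in A) g w =
  \int[P]_(w in A `&` E) g w + \int[P]_(w in A `\` E) g w.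
Proof.
move=> mA mE ig; rewrite -{1}(setUIDK A E) Rintegral_setU//.
- exact: measurableI.
- exact: measurableD.
- by rewrite setUIDK.
- by apply/disj_setPS => w [[_ Ew] [_ nEw]].
Qed.

End BoundedIntegrals.

(** * The integral of a bounded vector-valued map, tested by functionals *)

Section VectorMean.
Context {R : realType} {B : completeNormedModType R}.
Context {d : measure_display} {Omega : measurableType d}.
Variable P : probability Omega R.
Variable beta : R.
Hypothesis smoothB : beta_smooth B beta.
Hypothesis sepB : separable B.
Variables (Y : Omega -> B) (c : R).
Hypothesis bY : borel_meas measurable Y.
Hypothesis Yc : forall w, `|Y w| <= c.

Lemma measurable_bounded_linear f : bounded_linear f ->
  measurable_fun setT (f \o Y).
Proof.
move=> /bounded_linear_clf[_ cf]; apply: borel_meas_measurable_fun.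
exact: borel_meas_comp.
Qed.

Lemma integrable_bounded_linear f A : bounded_linear f -> measurable A ->
  P.-integrable A (EFin \o (f \o Y)).
Proof.
move=> bf mA; have [_ [C fC]] := bf.
apply: (@integrable_bounded _ _ _ P A (f \o Y) (`|C| * c)) => //.
  exact: measurable_bounded_linear.
move=> w /=; apply: (le_trans (fC _)); apply: (@le_trans _ _ (`|C| * `|Y w|)).
  by rewrite ler_wpM2r// ler_norm.
by rewrite ler_wpM2l.
Qed.

(** M is the integral of a simple function: A is cut into pieces on which Y is within e/2 of a point
    of a dense sequence. M does not depend on f, so a functional may later be chosen after it. *)
Lemma approx_vector_integral A (e : R) : measurable A -> 0 < e ->
  exists M : B, forall f C, bounded_linear f -> 0 <= C ->
    (forall x, `|f x| <= C * `|x|) ->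
    `|\int[P]_(w in A) f (Y w) - f M| <= C * e.
Proof.
move=> mA e0; have [x_ dense_x] := separable_dense_seq sepB.
pose E q := [set w | `|Y w - x_ q| < e / 2].
have mE q : measurable (E q).
  exact: (borel_meas_ball _ _ bY).
pose A_ := fix A_ N := if N is n.+1 then A_ n `\` E n else A.
have mA_ N : measurable (A_ N) by elim: N => //= n IH; exact: measurableD.
(* The error is charged only to the part already cut off; [A_ N] is the remainder. *)
have step N : exists M : B, forall f C, bounded_linear f -> 0 <= C ->
    (forall x, `|f x| <= C * `|x|) ->
    `|\int[P]_(w in A) f (Y w) - f M - \int[P]_(w in A_ N) f (Y w)| <=
    C * (e / 2) * (fine (P A) - fine (P (A_ N))).
  elim: N => [|N [M HM]].
    exists 0 => f C bf C0 fC; rewrite bounded_linear0// subr0 subrr normr0.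
    by rewrite subrr mulr0.
  exists (M + fine (P (A_ N `&` E N)) *: x_ N) => f C bf C0 fC.
  have := HM f C bf C0 fC.
  rewrite (Rintegral_splitI (mA_ N) (mE N)); last exact: integrable_bounded_linear.
  rewrite (fine_prob_splitI P (mA_ N) (mE N)) (bounded_linearD _ _ bf)
    (bounded_linearZ _ _ bf).
  set I0 := Rintegral _ _ _; set I1 := Rintegral _ _ _; set I2 := Rintegral _ _ _.
  set p1 := fine (P (A_ N `&` E N)) => h.
  have : `|I1 - p1 * f (x_ N)| <= C * (e / 2) * p1.
    rewrite /I1 /p1 mulrC -Rintegral_cst; last exact: measurableI.
    rewrite -RintegralB; last 3 first.
    - exact: measurableI.
    - by apply: integrable_bounded_linear => //; exact: measurableI.
    - by apply: finite_measure_integrable_cst; exact: measurableI.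
    apply: Rintegral_le_cst; first exact: measurableI.
      apply: (@integrable_bounded _ _ _ P _ _ (C * (c + `|x_ N|))).
      - exact: measurableI.
      - apply: measurable_funB => //; exact: measurable_bounded_linear.
      - move=> w; rewrite -bounded_linearB//; apply: (le_trans (fC _)).
        rewrite ler_wpM2l//; apply: (le_trans (ler_normB _ _)).
        by rewrite lerD2r.
    move=> w [_ Ew]; rewrite -bounded_linearB//; apply: (le_trans (fC _)).
    by rewrite ler_wpM2l// ltW.
  move: h; rewrite !ler_norml => /andP[h1 h2] /andP[h3 h4].
  rewrite -/I2; apply/andP; split; lra.
have A_0 : P (A_ n) @[n --> \oo] --> 0%E.
  have <- : P (\bigcap_n A_ n) = 0%E.
    rewrite (_ : \bigcap_n A_ n = set0) ?measure0//.
    apply/seteqP; split => // w Aw.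
    have [q wq] := dense_x (Y w) (e / 2) (divr_gt0 e0 (ltr0n R 2)).
    by have /= [] := Aw q.+1 Logic.I.
  apply: nonincreasing_cvg_mu => //.
  - by rewrite (le_lt_trans (probability_le1 P (mA_ 0)))// ltry.
  - exact: bigcapT_measurable.
  - by apply/nonincreasing_seqP => n; apply/subsetPset => w [].
(* The remainder has small probability and Y is bounded by c, so it uses the other half of e. *)
have [N PN] : exists N, c * fine (P (A_ N)) <= e / 2.
  have c0 : 0 <= c.
    exact: le_trans (Yc point).
  have c1 : 0 < c + 1 by rewrite ltr_wpDl.
  move/fine_cvgP : A_0 => [_ /cvgrPdist_lt /(_ (e / 2 / (c + 1)))].
  rewrite !divr_gt0// => /(_ isT)[N _ /(_ N (leqnn N))].
  rewrite /= sub0r normrN ger0_norm ?fine_prob_ge0// ltr_pdivlMr// => h.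
  exists N; apply: le_trans (ltW h); rewrite mulrC ler_wpM2l ?fine_prob_ge0//.
  by rewrite lerDl.
have [M HM] := step N; exists M => f C bf C0 fC.
have := HM f C bf C0 fC.
have : `|\int[P]_(w in A_ N) f (Y w)| <= C * c * fine (P (A_ N)).
  apply: Rintegral_le_cst => //; first exact: integrable_bounded_linear.
  by move=> w _; apply: (le_trans (fC _)); rewrite ler_wpM2l.
have : C * (c * fine (P (A_ N))) <= C * (e / 2) by rewrite ler_wpM2l.
have : C * (e / 2) * (fine (P A) - fine (P (A_ N))) <= C * (e / 2).
  rewrite ler_piMr ?mulr_ge0 ?divr_ge0 ?(ltW e0)//.
  rewrite lerBlDr (@le_trans _ _ 1) ?lerDl ?fine_prob_ge0//.
  by rewrite -lee_fin fine_probK// probability_le1.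
rewrite !ler_norml => h1 h2 /andP[h3 h4] /andP[h5 h6].
by apply/andP; split; lra.
Qed.

Lemma vector_integral A : measurable A -> exists M : B,
  forall f, bounded_linear f -> \int[P]_(w in A) f (Y w) = f M.
Proof.
move=> mA.
pose e_ n : R := n.+1%:R^-1.
have e_gt0 n : 0 < e_ n by rewrite invr_gt0.
have /choice[M_ M_P] n := approx_vector_integral mA (e_gt0 n).
(* A functional norming M_n - M_m sees both as approximations of the same number, so the sequence is
   Cauchy. *)
have M_dist n m : `|M_ n - M_ m| <= e_ n + e_ m.
  have [f [bf fE f1]] := norming_functional smoothB (M_ n - M_ m).
  have f1' x : `|f x| <= 1 * `|x| by rewrite mul1r.
  have := M_P n f 1 bf ler01 f1'; have := M_P m f 1 bf ler01 f1'.
  rewrite -fE (bounded_linearB _ _ bf) !mul1r !ler_norml => /andP[h1 h2] /andP[h3 h4].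
  lra.
have e_lt (e : R) : 0 < e -> \forall n \near \oo, e_ n < e.
  by move=> e0; exact: near_infty_natSinv_lt (PosNum e0).
have cM : cvgn M_.
  apply/cauchy_cvgP/cauchy_ballP => e e0; rewrite near_map2.
  have e20 : 0 < e / 2 by rewrite divr_gt0.
  exists ([set n | e_ n < e / 2], [set n | e_ n < e / 2]); first by split; exact: e_lt.
  move=> [n m] /= [hn hm]; rewrite -ball_normE /ball_/=.
  by apply: (le_lt_trans (M_dist _ _)); rewrite [e]splitr ltrD.
exists (limn M_) => f bf; have [_ [C fC]] := bf.
have [_ cf] := bounded_linear_clf bf.
have fM : f (M_ n) @[n --> \oo] --> f (limn M_).
  by apply: (cvg_comp _ _ cM); exact: cf.
apply/esym; apply: (cvg_unique _ fM) => //.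
have fC' x : `|f x| <= `|C| * `|x|.
  by apply: (le_trans (fC _)); rewrite ler_wpM2r// ler_norm.
have C1 : 0 < `|C| + 1 by rewrite ltr_wpDl.
apply/cvgrPdist_lt => e e0; near=> n.
apply: (le_lt_trans (M_P n f `|C| bf (normr_ge0 _) fC')).
apply: (@le_lt_trans _ _ ((`|C| + 1) * e_ n)); first by rewrite ler_wpM2r ?ltW// ltrDl.
rewrite mulrC -ltr_pdivlMr//; near: n; apply: e_lt; exact: divr_gt0.
Unshelve. all: by end_near. Qed.

End VectorMean.

(** * One step of the walk over an event, with z and x frozen *)

Section OneStep.
Context {R : realType} {B : completeNormedModType R}.
Context {d : measure_display} {Omega : measurableType d}.
Variable P : probability Omega R.
Variables beta p v r lam : R.
Hypothesis smoothB : beta_smooth B beta.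
Hypothesis beta1 : 1 <= beta.
Hypothesis sepB : separable B.
Hypothesis p12 : 1 < p <= 2.
Hypothesis lam0 : 0 < lam.
Variables (A : set Omega) (X : Omega -> B) (mu z x : B).
Hypothesis mA : measurable A.
Hypothesis bX : borel_meas measurable X.
Hypothesis iX : P.-integrable setT (fun w => (`|X w|)%:E).
Hypothesis meanX : forall f : B -> R, clf f ->
  (\int[P]_(w in A) (f (X w))%:E = (f mu)%:E * P A)%E.
Hypothesis momX : (\int[P]_(w in A) (`|X w - mu| `^ p)%:E <= v%:E * P A)%E.
Hypothesis zr : `|z - mu| <= r.

Local Notation pi := (fine (P A)).
Local Notation E g := (\int[P]_(w in A) g w).
Let T w : B := clip lam (X w - z).
Let V := v + r `^ p.

Let p1 : 1 < p. Proof. by case/andP: p12. Qed.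
Let beta0 : 0 < beta. Proof. exact: lt_le_trans beta1. Qed.
Let sO : sigma_algebra setT (@measurable d Omega).
Proof. exact: sigma_algebra_measurable. Qed.
Let linv0 : 0 <= lam^-1. Proof. by rewrite invr_ge0 ltW. Qed.
Let pi0 : 0 <= pi. Proof. exact: fine_prob_ge0. Qed.
Let r0 : 0 <= r. Proof. exact: le_trans zr. Qed.

Let bT : borel_meas measurable T.
Proof.
apply: (@borel_meas_lipschitz2 _ _ _ _ sO sepB B (fun y c => clip lam (y - c)) 2
  X (fun=> z)) => //; last exact: borel_meas_cst.
move=> y c y' c'; apply: (le_trans (clip_lipschitz _ _ lam0)).
rewrite ler_wpM2l// opprD addrACA; apply: (le_trans (ler_normD _ _)).
by rewrite lerD2l opprK -normrN opprD opprK.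
Qed.

Let Tle w : `|T w| <= lam^-1. Proof. exact: norm_clip_le. Qed.

Let integrable_compT (phi : B -> R) (c : R) : continuous phi ->
  (forall y, `|y| <= lam^-1 -> `|phi y| <= c) ->
  P.-integrable A (EFin \o (fun w => phi (T w))).
Proof.
move=> cphi phic; apply: (@integrable_bounded _ _ _ P _ _ c) => //.
  by apply: borel_meas_measurable_fun; exact: borel_meas_comp.
by move=> w; exact: phic.
Qed.

Let norm_continuousB (a : B) : continuous (fun y : B => `|y - a|).
Proof. by move=> y; apply: cvg_norm; apply: cvgB; [exact: cvg_id|exact: cvg_cst]. Qed.

Let sqr_continuousB (a : B) : continuous (fun y : B => `|y - a| ^+ 2).
Proof.
move=> y; apply: (@continuous_comp _ _ _ (fun y : B => `|y - a|) (fun t : R => t ^+ 2)).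
  exact: norm_continuousB.
exact: exprn_continuous.
Qed.

Let sqr_integrable (a : B) :
  P.-integrable A (EFin \o (fun w => `|T w - a| ^+ 2)).
Proof.
apply: (@integrable_compT (fun y => `|y - a| ^+ 2) ((lam^-1 + `|a|) ^+ 2)).
  exact: sqr_continuousB.
move=> y yl; rewrite ger0_norm ?sqr_ge0// lerXn2r ?nnegrE ?addr_ge0//.
by apply: (le_trans (ler_normB _ _)); rewrite lerD2r.
Qed.

Let sqr0_integrable : P.-integrable A (EFin \o (fun w => `|T w| ^+ 2)).
Proof.
have := sqr_integrable 0; congr (P.-integrable _ _).
by apply/funext => w /=; rewrite subr0.
Qed.

Let lin_integrable f : bounded_linear f ->
  P.-integrable A (EFin \o (fun w => f (T w))).
Proof. by move=> bf; exact: (integrable_bounded_linear P bT Tle bf mA). Qed.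

Let mom_measurable : measurable_fun setT (fun w => `|X w - mu| `^ p).
Proof.
apply: (@measurableT_comp _ _ _ _ _ _ (@powR R ^~ p)) => //.
apply: borel_meas_measurable_fun.
by apply: (@borel_meas_comp _ _ _ _ (fun y : B => `|y - mu|)) => //.
Qed.

Let mom_integrable : P.-integrable A (EFin \o (fun w => `|X w - mu| `^ p)).
Proof.
apply/integrableP; split; first by apply/measurable_EFinP; exact: measurable_funTS.
under eq_integral do rewrite /= ger0_norm ?powR_ge0//.
by apply: (le_lt_trans momX); rewrite -fine_probK// -EFinM ltry.
Qed.

Let mom_le : E (fun w => `|X w - mu| `^ p) <= v * pi.
Proof.
rewrite -lee_fin EFinM fine_probK// /Rintegral fineK//.
exact: integrable_fin_num.
Qed.

Let v0 : 0 < pi -> 0 <= v.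
Proof.
move=> p0; rewrite -(pmulr_lge0 _ p0); apply: le_trans mom_le.
by apply: Rintegral_ge0 => w _; exact: powR_ge0.
Qed.

(** Splitting X - z at mu is the source of 2^(p-1) and of v + r^p in the constants. *)
Let domin w : (lam * `|X w - z|) `^ p <=
  lam `^ p * 2 `^ (p - 1) * (`|X w - mu| `^ p + r `^ p).
Proof.
rewrite powRM ?(ltW lam0)// -mulrA ler_wpM2l ?powR_ge0//.
have -> : X w - z = (X w - mu) + (mu - z) by rewrite addrA subrK.
apply: (le_trans (powR_normD_le _ _ (ltW p1))); rewrite ler_wpM2l ?powR_ge0//.
rewrite lerD2l ge0_ler_powR ?nnegrE// ?(le_trans _ (ltW p1))//.
by rewrite distrC.
Qed.

Let domin_integrable (c : R) : P.-integrable A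
  (EFin \o (fun w => c * (`|X w - mu| `^ p + r `^ p))).
Proof.
apply: integrable_realZ => //; apply: integrable_realD => //.
exact: integrable_realC.
Qed.

Let domin_le (c : R) : 0 <= c ->
  E (fun w => c * (`|X w - mu| `^ p + r `^ p)) <= c * V * pi.
Proof.
move=> c0; rewrite RintegralZl//; last first.
  by apply: integrable_realD => //; exact: integrable_realC.
rewrite -mulrA ler_wpM2l// RintegralD//; last exact: integrable_realC.
by rewrite Rintegral_cst// /V mulrDl lerD2r.
Qed.

Let sqrT_le : lam ^+ 2 * E (fun w => `|T w| ^+ 2) <= lam `^ p * 2 `^ (p - 1) * V * pi.
Proof.
have i0 := sqr0_integrable.
rewrite -RintegralZl//; apply: le_trans (domin_le _); last first.
  by rewrite mulr_ge0 ?powR_ge0.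
apply: le_Rintegral => //.
  exact: integrable_realZ.
move=> w _; rewrite -exprMn; apply: le_trans (domin w).
exact: sqr_clip_le.
Qed.

Let s := lam / beta.
Let psi := (expR (2 / beta) - 2 / beta - 1) / (2 / beta) ^+ 2.

Let psi0 : 0 <= psi.
Proof.
by rewrite divr_ge0 ?sqr_ge0//; have := expR_ge1Dx (2 / beta); lra.
Qed.

(** Isolates the factor 1 or 4, which is the constant of [variance_le]. *)
Let Cfrak_psi : Cfrak B beta p =
  (if `[< is_hilbert B >] then 1 else 4) * 2 `^ (p - 1) * psi.
Proof.
rewrite /Cfrak -/psi; case: ifP => _; first by rewrite mul1r.
congr (_ * _); rewrite (_ : p + 1 = 2%:R + (p - 1)); last by ring.
rewrite (@powRD _ 2 2%:R (p - 1)) ?pnatr_eq0 ?implybT// (@powR_mulrn _ 2 2)//.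
by rewrite (_ : 2 ^+ 2 = 4 :> R)//; ring.
Qed.

(** Logarithmic growth per step: the first summand pays for the second-order term, the one divided
    by beta for the truncation bias. *)
Definition step_exponent : R :=
  lam `^ p * (Cfrak B beta p + 2 `^ (p - 1) * Kp p / beta) * (v + r `^ p).

Let step_integrable : P.-integrable A
  (EFin \o (fun w => cosh (s * `|x + (T w + z - mu)|))).
Proof.
have s0 : 0 <= s by rewrite divr_ge0 ?ltW.
apply: (@integrable_compT (fun y => cosh (s * `|x + (y + z - mu)|))
  (cosh (s * (`|x| + (lam^-1 + `|z - mu|))))).
  move=> y; apply: (@continuous_comp _ _ _ (fun y => s * `|x + (y + z - mu)|) cosh).
    apply: cvgM; first exact: cvg_cst.
    apply: cvg_norm; apply: cvgD; first exact: cvg_cst.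
    apply: cvgB; last exact: cvg_cst.
    by apply: cvgD; [exact: cvg_id|exact: cvg_cst].
  exact: continuous_cosh.
move=> y yl; rewrite ger0_norm ?(ltW (cosh_gt0 _))//.
apply: le_cosh; first by rewrite mulr_ge0.
rewrite ler_wpM2l// (le_trans (ler_normD _ _))// lerD2l -addrA.
by rewrite (le_trans (ler_normD _ _))// lerD2r.
Qed.

Section Centered.
Variable m : B.
Hypothesis pi_gt0 : 0 < pi.
Hypothesis mP : forall f, bounded_linear f -> E (fun w => f (T w)) = pi * f m.

Let norm_m : `|m| <= lam^-1.
Proof.
have [f [bf fm f1]] := norming_functional smoothB m.
rewrite -(ler_pM2l pi_gt0) -fm -mP// mulrC -Rintegral_cst//.
apply: le_Rintegral => //.
- exact: lin_integrable.
- exact: integrable_realC.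
- by move=> w _; apply: (le_trans (ler_norm _)); apply: (le_trans (f1 _)).
Qed.

(** Jensen's inequality from the tangent bound 2||m|| f(T) - ||m||^2 <= ||T||^2, with f norming
    m. *)
Let sqr_m : pi * `|m| ^+ 2 <= E (fun w => `|T w| ^+ 2).
Proof.
have [f [bf fm f1]] := norming_functional smoothB m.
have -> : pi * `|m| ^+ 2 = E (fun w => 2 * `|m| * f (T w) - `|m| ^+ 2).
  rewrite RintegralB//; last 2 first.
  - by apply: integrable_realZ => //; exact: lin_integrable.
  - exact: integrable_realC.
  rewrite RintegralZl//; last exact: lin_integrable.
  by rewrite mP// Rintegral_cst// fm; ring.
apply: le_Rintegral => //.
  apply: (@integrable_compT (fun y => 2 * `|m| * f y - `|m| ^+ 2)
    (2 * `|m| * lam^-1 + `|m| ^+ 2)).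
    move=> y; apply: cvgB; last exact: cvg_cst.
    apply: cvgM; first exact: cvg_cst.
    by have [_ cf] := bounded_linear_clf bf; exact: cf.
  move=> y yl; apply: (le_trans (ler_normB _ _)).
  rewrite [`|_ ^+ 2|]ger0_norm ?sqr_ge0// lerD2r normrM ger0_norm ?mulr_ge0//.
  by rewrite ler_wpM2l ?mulr_ge0// (le_trans (f1 _)).
move=> w _; have : f (T w) <= `|T w| by rewrite (le_trans (ler_norm _)).
move=> h; have := ler_wpM2l (normr_ge0 m) h; have := sqr_ge0 (`|T w| - `|m|); lra.
Qed.

(** In a Hilbert space the inner product with m has mean ||m||^2, so centring only decreases the
    second moment. Otherwise ||T - m||^2 <= 2||T||^2 + 2||m||^2, and [sqr_m] gives 4. *)
Let variance_le : E (fun w => `|T w - m| ^+ 2) <=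
  (if `[< is_hilbert B >] then 1 else 4) * E (fun w => `|T w| ^+ 2).
Proof.
have i0 := sqr0_integrable.
case: asboolP => [[ip [ipC [ipl ipE]]]|_].
  have ipx (a b : B) : ip a b = (`|a + b| ^+ 2 - `|a| ^+ 2 - `|b| ^+ 2) / 2.
    have ipD (a' b' c' : B) : ip (a' + b') c' = ip a' c' + ip b' c'.
      by rewrite -{1}(scale1r a') ipl mul1r.
    rewrite -!ipE ipD (ipC a (a + b)) (ipC b (a + b)) !ipD (ipC b a).
    by field.
  (* Cauchy-Schwarz read off the triangle inequality through polarisation. *)
  have ble (a b : B) : ip a b <= `|a| * `|b|.
    rewrite ipx; have : `|a + b| ^+ 2 <= (`|a| + `|b|) ^+ 2.
      by rewrite lerXn2r ?nnegrE ?addr_ge0// ler_normD.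
    lra.
  have ipN (a b : B) : ip (- a) b = - ip a b.
    have := ipl (-1) a 0 b; rewrite scaleN1r addr0 => ->.
    have := ipl 1 0 0 b; rewrite scale1r addr0; lra.
  have bip : bounded_linear (fun y => ip y m).
    split; first by move=> a y y'; exact: ipl.
    exists `|m| => y; rewrite ler_norml mulrC ble andbT -(normrN y).
    by have := ble (- y) m; rewrite ipN; lra.
  have -> : E (fun w => `|T w - m| ^+ 2) =
      E (fun w => `|T w| ^+ 2 - (2 * ip (T w) m - `|m| ^+ 2)).
    apply: eq_Rintegral => w _; have := ipx (T w) (- m).
    by rewrite ipC ipN ipC normrN; lra.
  have i2 : P.-integrable A (EFin \o (fun w => 2 * ip (T w) m)).
    by apply: integrable_realZ => //; exact: (lin_integrable bip).
  have i3 := integrable_realC P (`|m| ^+ 2) mA.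
  rewrite RintegralB//; last exact: integrable_realB.
  rewrite RintegralB// RintegralZl//; last exact: (lin_integrable bip).
  rewrite (mP bip) Rintegral_cst// ipE mul1r.
  have := mulr_ge0 pi0 (sqr_ge0 `|m|); lra.
apply: (@le_trans _ _ (E (fun w => 2 * `|T w| ^+ 2 + 2 * `|m| ^+ 2))).
  have i2 : P.-integrable A (EFin \o (fun w => 2 * `|T w| ^+ 2)).
    exact: integrable_realZ.
  apply: le_Rintegral => //.
    by apply: integrable_realD => //; exact: integrable_realC.
  move=> w _; have h : `|T w - m| ^+ 2 <= (`|T w| + `|m|) ^+ 2.
    by rewrite lerXn2r ?nnegrE ?addr_ge0// ler_normB.
  have := sqr_ge0 (`|T w| - `|m|); lra.
rewrite RintegralD//; last 2 first.
- exact: integrable_realZ.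
- exact: integrable_realC.
by rewrite RintegralZl// Rintegral_cst//; move: sqr_m; lra.
Qed.

(** The mean over A of the increment T + z - mu. *)
Let b := m - (mu - z).

(** For a functional f norming b, the weak mean of X turns f(b) into the mean of f(T - (X - z)),
    which is pure truncation error. *)
Let bias_le : lam * `|b| <= Kp p * (lam `^ p * 2 `^ (p - 1)) * V.
Proof.
have [f [bf fb f1]] := norming_functional smoothB b.
have iT := lin_integrable bf.
have ifX : P.-integrable A (EFin \o (fun w => f (X w))).
  apply: (integrableS _ mA (@subsetT _ A)) => //.
  apply: (le_integrable _ _ _ iX) => //.
    by apply/measurable_EFinP; exact: measurable_bounded_linear.
  by move=> w _; rewrite /= lee_fin [leRHS]ger0_norm.
have EX : E (fun w => f (X w)) = f mu * pi.
  by rewrite /Rintegral (meanX (bounded_linear_clf bf)) fineM// fin_num_measure.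
have Eb : pi * f b = E (fun w => f (T w) - (f (X w) - f z)).
  rewrite RintegralB//; last first.
    by apply: integrable_realB => //; exact: integrable_realC.
  rewrite RintegralB//; last exact: integrable_realC.
  by rewrite mP// EX Rintegral_cst// /b !(bounded_linearB _ _ bf); ring.
rewrite -(ler_pM2r pi_gt0) -fb.
have -> : lam * f b * pi = E (fun w => lam * (f (T w) - (f (X w) - f z))).
  rewrite RintegralZl//; first by rewrite -Eb; ring.
  by apply: integrable_realB => //; apply: integrable_realB => //; exact: integrable_realC.
have K0 := Kp_gt0 p1.
apply: le_trans (domin_le _); last first.
  exact: mulr_ge0 (ltW K0) (mulr_ge0 (powR_ge0 _ _) (powR_ge0 _ _)).
apply: le_Rintegral => //.
  by apply: integrable_realZ => //; apply: integrable_realB => //;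
    apply: integrable_realB => //; exact: integrable_realC.
move=> w _; rewrite -!(bounded_linearB _ _ bf).
apply: (@le_trans _ _ (lam * `|T w - (X w - z)|)).
  by rewrite ler_pM2l// (le_trans (ler_norm _)).
apply: (le_trans (clip_bias _ lam0 p1)); rewrite -[leRHS]mulrA.
by rewrite ler_wpM2l ?(ltW K0)// domin.
Qed.

Lemma cosh_step_centered :
  E (fun w => cosh (s * `|x + (T w + z - mu)|)) <=
  expR step_exponent * cosh (s * `|x|) * pi.
Proof.
have s0 : 0 < s by rewrite divr_gt0.
(* The base point absorbs the bias, so the increment s(T - m) is centred and the linear term
   integrates to 0. *)
have [f bf fP] := cosh_norm_smooth smoothB beta1 (s *: (x + b)).
set c0 := cosh `|s *: (x + b)| in fP *.
have c00 : 0 < c0 := cosh_gt0 _.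
have iT := lin_integrable bf; have iS := sqr_integrable m.
pose g w := c0 - s * f m + (s * f (T w) + c0 * psi * lam ^+ 2 * `|T w - m| ^+ 2).
have ig : P.-integrable A (EFin \o g).
  apply: integrable_realD => //; first exact: integrable_realC.
  by apply: integrable_realD => //; exact: integrable_realZ.
have le_g w : cosh (s * `|x + (T w + z - mu)|) <= g w.
  have := fP (s *: (T w - m)).
  rewrite -scalerDr normrZ (gtr0_norm s0) [in X in _ <= X]normrZ (gtr0_norm s0).
  have -> : x + b + (T w - m) = x + (T w + z - mu).
    rewrite /b opprB -addrA (addrC (T w)) addrACA subrr add0r.
    by rewrite (addrC _ (T w)) (addrA (T w)).
  rewrite (bounded_linearZ _ _ bf) (bounded_linearB _ _ bf) => /le_trans; apply.
  have u0 : 0 <= s * `|T w - m| by rewrite mulr_ge0// ltW.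
  have u2 : s * `|T w - m| <= 2 / beta.
    rewrite /s mulrAC ler_pM2r ?invr_gt0// -ler_pdivlMl//.
    by rewrite (le_trans (ler_normB _ _))// mulrC mulr_natl mulr2n lerD.
  have := expR_taylor2_le (divr_gt0 (ltr0n R 2) beta0) u0 u2; rewrite -/psi => h.
  have {}h := ler_wpM2l (ltW c00) (ler_wpM2l (sqr_ge0 beta) h).
  have E1 : c0 * (beta ^+ 2 * (psi * (s * `|T w - m|) ^+ 2)) =
      c0 * psi * lam ^+ 2 * `|T w - m| ^+ 2.
    by rewrite /s; field; rewrite gt_eqF.
  by move: h; rewrite E1 /g; lra.
have Eg : E g = c0 * pi + c0 * psi * (lam ^+ 2 * E (fun w => `|T w - m| ^+ 2)).
  have iS' := integrable_realZ (c0 * psi * lam ^+ 2) mA iS.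
  have iT' := integrable_realZ s mA iT.
  rewrite /g RintegralD//; [|exact: integrable_realC|exact: integrable_realD].
  by rewrite Rintegral_cst// RintegralD// !RintegralZl// mP//; ring.
apply: (@le_trans _ _ (E g)); first by apply: le_Rintegral => // w _; exact: le_g.
set q := lam `^ p * Cfrak B beta p * V.
have h1 : E g <= c0 * (1 + q) * pi.
  rewrite Eg; set ch := (if `[< is_hilbert B >] then 1 else 4 : R).
  have ch0 : 0 <= ch by rewrite /ch; case: ifP.
  have h := ler_wpM2l (sqr_ge0 lam) variance_le.
  have {}h : lam ^+ 2 * E (fun w => `|T w - m| ^+ 2) <=
      ch * (lam `^ p * 2 `^ (p - 1) * V * pi).
    by apply: (le_trans h); rewrite mulrCA ler_wpM2l.
  have := ler_wpM2l (mulr_ge0 (ltW c00) psi0) h.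
  by rewrite /q Cfrak_psi -/ch; lra.
apply: (le_trans h1); rewrite ler_pM2r//.
have h2 : c0 <= expR (s * `|b|) * cosh (s * `|x|).
  rewrite /c0; apply: le_trans (coshD_le _ _); last by rewrite mulr_ge0// ltW.
  by rewrite le_cosh// normrZ gtr0_norm// -mulrDr ler_pM2l// ler_normD.
have V0 : 0 <= V by rewrite addr_ge0 ?powR_ge0 ?v0.
have q0 : 0 <= 1 + q.
  rewrite addr_ge0// /q Cfrak_psi; apply: mulr_ge0 => //.
  apply: mulr_ge0; first exact: powR_ge0.
  by apply: mulr_ge0 => //; apply: mulr_ge0; [case: ifP|exact: powR_ge0].
apply: (@le_trans _ _ (expR (s * `|b|) * cosh (s * `|x|) * expR q)).
  apply: ler_pM => //; [exact: ltW|exact: expR_ge1Dx].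
rewrite mulrAC -expRD ler_wpM2r ?(ltW (cosh_gt0 _))// ler_expR.
have : s * `|b| <= 2 `^ (p - 1) * Kp p / beta * lam `^ p * V.
  rewrite /s mulrAC ler_pdivrMr//; apply: (le_trans bias_le).
  rewrite le_eqVlt; apply/orP; left; apply/eqP.
  by field; rewrite gt_eqF.
by rewrite /step_exponent /q -/V; lra.
Qed.

End Centered.

Lemma cosh_one_step :
  (\int[P]_(w in A) (cosh (lam / beta * `|x + (clip lam (X w - z) + z - mu)|))%:E <=
   (expR step_exponent * cosh (lam / beta * `|x|))%:E * P A)%E.
Proof.
(* On a null event the mean over A is undefined, but both sides vanish. *)
have [pi_eq0|pi_neq0] := eqVneq pi 0.
  have PA0 : P A = 0%E by rewrite -fine_probK// pi_eq0.
  rewrite PA0 mule0 null_set_integral//.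
  by case/integrableP: step_integrable.
have pi_gt0 : 0 < pi by rewrite lt_neqAle eq_sym pi_neq0.
have [M MP] := vector_integral P smoothB sepB bT Tle mA.
have mP f : bounded_linear f -> E (fun w => f (T w)) = pi * f (pi^-1 *: M).
  by move=> bf; rewrite MP// (bounded_linearZ _ _ bf) mulrA divff// mul1r.
rewrite -fine_probK// -EFinM -[leLHS]fineK; last first.
  exact: (integrable_fin_num mA step_integrable).
by rewrite lee_fin; exact: (cosh_step_centered pi_gt0 mP).
Qed.

End OneStep.

(** * Cutting an event into pieces on which the past is nearly constant *)

Section Localization.
Context {R : realType} {B : normedModType R}.
Context {d : measure_display} {Omega : measurableType d}.
Variable P : probability Omega R.
Variable G : set (set Omega).
Hypothesis sG : sigma_algebra setT G.
Hypothesis Gm : G `<=` measurable.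
Hypothesis sepB : separable B.

(* Freezing the past in this way stands in for conditioning on G: all later
   estimates are integrals over events of G on which the past is almost
   constant. *)
Lemma le_integral_localize (Y : Omega -> B) (f g : Omega -> R) (e : R)
  (A : set Omega) :
  borel_meas G Y -> 0 < e ->
  (forall w, 0 <= f w) -> (forall w, 0 <= g w) ->
  measurable_fun setT f -> measurable_fun setT g ->
  (forall A' w0, G A' -> A' `<=` A -> A' w0 ->
     (forall w, A' w -> `|Y w - Y w0| < e) ->
     (\int[P]_(w in A') (f w)%:E <= \int[P]_(w in A') (g w)%:E)%E) ->
  G A -> (\int[P]_(w in A) (f w)%:E <= \int[P]_(w in A) (g w)%:E)%E.
Proof.
move=> bY e0 f0 g0 mf mg H GA; have [x_ dense_x] := separable_dense_seq sepB.
(* Radius e/2 about the dense points puts any two points of a piece at distance below e, so a point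
   of the piece itself can be the reference. *)
pose D q := A `&` [set w | `|Y w - x_ q| < e / 2].
have GD q : G (D q) by apply: sigma_setI => //; exact: borel_meas_ball.
have GU n : G (\big[setU/set0]_(k < n) D k).
  by elim/big_ind: _ => //; [exact: sigma_set0|exact: sigma_setU].
have GS q : G (seqDU D q) by exact: sigma_setD.
have AD : A = \bigcup_q seqDU D q.
  rewrite -seqDU_bigcup_eq; apply/seteqP; split=> [w Aw|w [q _ []]//].
  have [q h] := dense_x (Y w) (e / 2) (divr_gt0 e0 (ltr0n R 2)).
  by exists q.
have Dsub q w : seqDU D q w -> A w /\ `|Y w - x_ q| < e / 2.
  by move=> h; exact: (@subset_seqDU _ D q w h).
have mS q : measurable (seqDU D q) by exact: Gm.
have mbig : measurable (\bigcup_q seqDU D q) by exact: bigcupT_measurable.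
have expand (u : Omega -> R) : (forall w, 0 <= u w) -> measurable_fun setT u ->
    (\int[P]_(w in A) (u w)%:E = \sum_(q <oo) \int[P]_(w in seqDU D q) (u w)%:E)%E.
  move=> u0 mu; rewrite [in LHS]AD; apply: ge0_integral_bigcup => //.
  - by apply/measurable_EFinP; exact: measurable_funTS.
  - by move=> w _; rewrite lee_fin.
rewrite !expand//.
apply: lee_nneseries => [q _ _|q _].
  by apply: integral_ge0 => w _; rewrite lee_fin.
have [->|/set0P[w0 w0S]] := eqVneq (seqDU D q) set0.
  by rewrite !integral_set0.
apply: (H _ w0) => //.
  by move=> w /Dsub[].
move=> w /Dsub[_ h]; have [_ h0] := Dsub _ _ w0S.
rewrite -(subrK (x_ q) (Y w)) -addrA (le_lt_trans (ler_normD _ _))//.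
by rewrite [e]splitr [`|x_ q - _|]distrC ltrD.
Qed.

End Localization.

(** * A maximal inequality for nonnegative supermartingales on an event *)

Section Ville.
Context {R : realType} {d : measure_display} {Omega : measurableType d}.
Variable P : probability Omega R.
Variables (F : nat -> set (set Omega)) (W : nat -> Omega -> R) (D : set Omega) (c : R).
Hypothesis sF : forall n, sigma_algebra setT (F n).
Hypothesis Fm : forall n, F n `<=` measurable.
Hypothesis FS : forall n, F n `<=` F n.+1.
Hypothesis W0 : forall n w, 0 <= W n w.
Hypothesis mW : forall n, measurable_fun setT (W n).
Hypothesis FW : forall n, F n [set w | c <= W n w].
Hypothesis FD : F 0 D.
Hypothesis c0 : 0 < c.
Hypothesis superW : forall n A, F n A -> A `<=` D ->
  (\int[P]_(w in A) (W n.+1 w)%:E <= \int[P]_(w in A) (W n w)%:E)%E.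
Hypothesis initW : (\int[P]_(w in D) (W 0 w)%:E <= 1)%E.

Let E n := [set w | c <= W n w].
(** The part of D on which W has stayed below c up to time n; it replaces a stopping time. *)
Let Rm := fix Rm n := if n is n'.+1 then Rm n' `\` E n else D `\` E 0.

Let RmD n : Rm n `<=` D.
Proof. by elim: n => [w []//|n IH w [/IH]]. Qed.

Let FR n : F n (Rm n).
Proof.
elim: n => [|n IH] /=; first exact: sigma_setD.
by apply: sigma_setD => //; exact: FS.
Qed.

Let mE n : measurable (E n). Proof. exact: (Fm (FW n)). Qed.
Let mR n : measurable (Rm n). Proof. exact: (Fm (FR n)). Qed.
Let mD : measurable D. Proof. exact: (Fm FD). Qed.

Let split_int n A : measurable A ->
  (c%:E * P (A `&` E n) + \int[P]_(w in A `\` E n) (W n w)%:E <=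
   \int[P]_(w in A) (W n w)%:E)%E.
Proof.
move=> mA; have mI : measurable (A `&` E n) by exact: measurableI.
have mJ : measurable (A `\` E n) by exact: measurableD.
have -> : (\int[P]_(w in A) (W n w)%:E = \int[P]_(w in A `&` E n) (W n w)%:E +
    \int[P]_(w in A `\` E n) (W n w)%:E)%E.
  rewrite -[in LHS](setUIDK A (E n)); apply: ge0_integral_setU => //.
  - by apply/measurable_EFinP; exact: measurable_funTS.
  - by move=> w _; rewrite lee_fin.
  - by apply/disj_setPS => w [[_ Ew] [_ nEw]].
rewrite leeD2r// -integral_cst//; apply: ge0_le_integral => //.
- by move=> w _; rewrite lee_fin ltW.
- by apply/measurable_EFinP; exact: measurable_funTS.
- by move=> w [_ Ew]; rewrite lee_fin.
Qed.

(** The supermartingale inequality over [Rm n], an event of [F n], passes from [W n] to [W n.+1];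
    Markov's inequality then turns the newly hit part into probability. *)
Let hit_bound n : (c%:E * P (D `\` Rm n) + \int[P]_(w in Rm n) (W n w)%:E <= 1)%E.
Proof.
elim: n => [|n IH].
  have -> : D `\` Rm 0 = D `&` E 0 by rewrite /= setDDr setDv set0U.
  exact: le_trans (split_int 0 mD) initW.
have -> : D `\` Rm n.+1 = (D `\` Rm n) `|` (Rm n `&` E n.+1).
  apply/seteqP; split=> w /=.
    move=> [Dw nR]; have [Rw|] := pselect (Rm n w); last by left.
    by right; split=> //; apply: contrapT => nE; exact: nR.
  by move=> [[Dw nR]|[Rw Ew]]; split=> //; [case|exact: (RmD Rw)|case].
have mI : measurable (Rm n `&` E n.+1) by exact: measurableI.
have mJ : measurable (D `\` Rm n) by exact: measurableD.
rewrite measureU//; last by apply/seteqP; split=> // w [[_ nR] [Rw _]].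
rewrite muleDr ?fin_num_adde_defl ?fin_num_measure//.
rewrite -addeA; apply: le_trans IH; rewrite leeD2l//.
apply: (le_trans (split_int n.+1 (mR n))).
by apply: superW; [exact: FR|exact: RmD].
Qed.

Lemma ville_maximal :
  (P (D `&` \bigcup_n [set w | (c <= W n w)%R]) <= (c^-1)%:E)%E.
Proof.
have -> : D `&` \bigcup_n E n = \bigcup_n (D `\` Rm n).
  apply/seteqP; split=> w.
    move=> [Dw [n _ En]]; exists n => //; split=> //.
    by case: n En => [|n] En /= [].
  move=> [n _]; elim: n => [|n IH] [Dw nR].
    split=> //; exists 0 => //; apply: contrapT => nE; exact: nR.
  have [Rn|nRn] := pselect (Rm n w); last exact: IH.
  split=> //; exists n.+1 => //; apply: contrapT => nE; exact: nR.
have ndR : nondecreasing_seq (fun n => D `\` Rm n).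
  by apply/nondecreasing_seqP => n; apply/subsetPset => w [Dw nR]; split=> // -[].
have mH n : measurable (D `\` Rm n) by exact: measurableD.
have mU : measurable (\bigcup_n (D `\` Rm n)) by exact: bigcupT_measurable.
have := nondecreasing_cvg_mu (mu := P) mH mU ndR.
move=> /cvge_to_le; apply; apply: nearW => n /=.
rewrite -[leRHS]mule1 lee_pdivlMl//; apply: le_trans (hit_bound n).
by rewrite leeDl// integral_ge0// => w _; rewrite lee_fin.
Qed.

End Ville.

(** Removes the factor lost by freezing the past only up to e. *)
Lemma lee_of_expR_eps {R : realType} (x y : \bar R) : (0 <= x)%E -> (0 <= y)%E ->
  (forall t : R, 0 < t -> (x <= (expR t)%:E * y)%E) -> (x <= y)%E.
Proof.
case: y => [b| |] //; last by move=> _ _ _; rewrite leey.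
case: x => [a| |] // a0 b0 h; last by have := h 1 ltr01.
move: a0 b0; rewrite !lee_fin => a0 b0.
have {}h t : 0 < t -> a <= expR t * b by move=> /h; rewrite -EFinM lee_fin.
rewrite leNgt; apply/negP => ab.
have [b00|bn0] := eqVneq b 0; first by have := h 1 ltr01; rewrite b00 mulr0; lra.
have bp : 0 < b by rewrite lt_neqAle eq_sym bn0.
have ap : 0 < a by apply: le_lt_trans ab.
have l0 : 0 < ln (a / b) by rewrite ln_gt0// ltr_pdivlMr// mul1r.
have := h (ln (a / b) / 2) (divr_gt0 l0 (ltr0n R 2)); apply/negP; rewrite -ltNge.
rewrite -ltr_pdivlMr// -[ltRHS]lnK ?posrE ?divr_gt0// ltr_expR.
by rewrite ltr_pdivrMr//; lra.
Qed.

(** * Supermartingale property and maximal bound for the truncated walk *)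

Section TruncatedWalk.
Context {R : realType} {B : completeNormedModType R}.
Context {d : measure_display} {Omega : measurableType d}.
Variable P : probability Omega R.
Variables (F : nat -> set (set Omega)) (X : nat -> Omega -> B) (mu : B).
Variables beta p v r lam : R.
Hypothesis sepB : separable B.
Hypothesis smoothB : beta_smooth B beta.
Hypothesis beta1 : 1 <= beta.
Hypothesis filtF : filtration F.
Hypothesis adapted : forall n, (1 <= n)%N -> borel_meas (F n) (X n).
Hypothesis meanX : forall n, (1 <= n)%N -> cond_exp_eq P (F n.-1) (X n) mu.
Hypothesis p12 : 1 < p <= 2.
Hypothesis momX : forall n, (1 <= n)%N ->
  cond_exp_le P (F n.-1) (fun w => `|X n w - mu| `^ p) v.
Hypothesis lam0 : 0 < lam.
Variables (k : nat) (Z : Omega -> B).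
Hypothesis bZ : borel_meas (F k) Z.

(** The walk starts after time k, when Z is already known; i counts its steps, so its filtration is
    [F (k + i)]. *)
Definition truncated_walk i w : B :=
  \sum_(k.+1 <= m < (k + i).+1) (clip lam (X m w - Z w) + Z w - mu).

Let kappa : R := @step_exponent R B beta p v r lam.
Let s := lam / beta.
Let U i w := cosh (s * `|truncated_walk i w|).
Let D := [set w | `|Z w - mu| < r].

Let sF n : sigma_algebra setT (F n). Proof. by case: filtF. Qed.
Let Fm n : F n `<=` measurable. Proof. by case: filtF => _ []. Qed.
Let FS n : F n `<=` F n.+1. Proof. by case: filtF => _ []. Qed.
Let Fk i : F k `<=` F (k + i).
Proof.
elim: i => [|i IH]; first by rewrite addn0.
by rewrite addnS; exact: subset_trans (@FS _).
Qed.
Let beta0 : 0 < beta. Proof. exact: lt_le_trans beta1. Qed.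
Let s0 : 0 < s. Proof. by rewrite divr_gt0. Qed.

Lemma truncated_walkS i w : truncated_walk i.+1 w =
  truncated_walk i w + (clip lam (X (k + i).+1 w - Z w) + Z w - mu).
Proof. by rewrite /truncated_walk addnS big_nat_recr//= ltnS leq_addr. Qed.

Lemma truncated_walk_borel i : borel_meas (F (k + i)) (truncated_walk i).
Proof.
elim: i => [|i IH].
  rewrite (_ : truncated_walk 0 = fun=> 0); first exact: borel_meas_cst.
  by apply/funext => w; rewrite /truncated_walk addn0 big_geq.
rewrite addnS (_ : truncated_walk i.+1 = fun w => truncated_walk i w +
  (clip lam (X (k + i).+1 w - Z w) + Z w - mu)); last first.
  by apply/funext => w; exact: truncated_walkS.
have bT : borel_meas (F (k + i).+1)
    (fun w => clip lam (X (k + i).+1 w - Z w) + Z w - mu).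
  apply: (@borel_meas_lipschitz2 _ _ _ _ (@sF _) sepB B
    (fun y c => clip lam (y - c) + c - mu) 3).
  - move=> y c y' c'.
    have -> : clip lam (y - c) + c - mu - (clip lam (y' - c') + c' - mu) =
        (clip lam (y - c) - clip lam (y' - c')) + (c - c').
      by rewrite opprB addrA subrK opprD addrACA.
    apply: (le_trans (ler_normD _ _)).
    have := clip_lipschitz (y - c) (y' - c') lam0.
    have : `|y - c - (y' - c')| <= `|y - y'| + `|c - c'|.
      by rewrite opprD addrACA -opprD; exact: ler_normB.
    have := normr_ge0 (y - y'); have := normr_ge0 (c - c'); lra.
  - exact: adapted.
  - by apply: borel_measS bZ; rewrite -addnS; exact: Fk.
apply: (@borel_meas_lipschitz2 _ _ _ _ (@sF _) sepB B (fun y c => y + c) 1) => //.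
  by move=> y c y' c'; rewrite mul1r opprD addrACA ler_normD.
exact: borel_measS IH.
Qed.

Let contU : continuous (fun y : B => cosh (s * `|y|)).
Proof.
move=> y; apply: (@continuous_comp _ _ _ (fun y : B => s * `|y|) cosh).
  by apply: cvgM; [exact: cvg_cst|apply: cvg_norm; exact: cvg_id].
exact: continuous_cosh.
Qed.

Let bU i : borel_meas (F (k + i)) (U i).
Proof.
exact (borel_meas_comp contU (@truncated_walk_borel i)).
Qed.

Let mU i : measurable_fun setT (U i).
Proof. by apply: borel_meas_measurable_fun; apply: borel_measS (bU i); exact: Fm. Qed.

Let U0 i w : 0 <= U i w. Proof. exact/ltW/cosh_gt0. Qed.

Let FD : F k D. Proof. exact: borel_meas_ball. Qed.

Let step_local i A w0 w1 (e : R) : 0 < e -> F (k + i) A -> A `<=` D -> A w1 ->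
  (forall w, A w -> `|truncated_walk i w - truncated_walk i w0| < e) ->
  (forall w, A w -> `|Z w - Z w1| < e) ->
  (\int[P]_(w in A) (U i.+1 w)%:E <=
   \int[P]_(w in A) (expR (kappa + 5 * (s * e)) * U i w)%:E)%E.
Proof.
move=> e0 FA AD Aw1 hS hZ; have mA := Fm FA.
set x := truncated_walk i w0; set z := Z w1; set n := (k + i).+1.
(* Here it matters that z is the value of Z at a point of A, which lies in D; a nearby dense point
   could violate the bound. *)
have zr : `|z - mu| <= r by apply/ltW/AD.
have bX : borel_meas measurable (X n).
  by apply: borel_measS (adapted _) => //; exact: Fm.
have [iX mX] := meanX (ltn0Sn (k + i)).
have := @cosh_one_step _ _ _ _ P beta p v r lam smoothB beta1 sepB p12 lam0 A
  (X n) mu z x mA bX iX (fun f cf => mX f cf A FA) (momX (ltn0Sn (k + i)) FA) zr.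
rewrite -/kappa -/s => one_step.
pose g w := cosh (s * `|x + (clip lam (X n w - z) + z - mu)|).
have mg : measurable_fun setT g.
  apply: borel_meas_measurable_fun.
  have bY : borel_meas measurable (fun w => x + (clip lam (X n w - z) + z - mu)).
    apply: (@borel_meas_lipschitz2 _ _ _ _ (@sigma_algebra_measurable d Omega) sepB B
      (fun y c => c + (clip lam (y - z) + z - mu)) 2 (X n) (fun=> x)) => //.
      move=> y c y' c'; rewrite opprD addrACA -2!(addrA _ z).
      rewrite (opprD (clip lam _)) (addrACA (clip lam _)) subrr addr0 addrC.
      apply: (le_trans (ler_normD _ _)); rewrite mulrDr.
      have := clip_lipschitz (y - z) (y' - z) lam0.
      rewrite opprB addrA subrK; have := normr_ge0 (c - c'); lra.
    by apply: borel_meas_cst; exact: sigma_algebra_measurable.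
  exact (borel_meas_comp contU bY).
have step1 : (\int[P]_(w in A) (U i.+1 w)%:E <=
    \int[P]_(w in A) ((expR (4 * (s * e)))%:E * (g w)%:E))%E.
  apply: ge0_le_integral => //.
  - by move=> w _; rewrite lee_fin.
  - by apply/measurable_EFinP; exact: measurable_funTS.
  - by apply/measurable_EFinP; apply: measurable_funTS; exact: measurable_funM.
  move=> w Aw; rewrite -EFinM lee_fin.
  apply: le_trans (coshD_le _ _); last first.
    by apply: mulr_ge0 => //; exact/ltW/mulr_gt0.
  apply: le_cosh; first by rewrite mulr_ge0// ltW.
  rewrite mulrCA -mulrDr ler_pM2l// truncated_walkS.
  have dS := hS _ Aw; have dZ := hZ _ Aw.
  have := clip_lipschitz (X n w - Z w) (X n w - z) lam0.
  have -> : X n w - Z w - (X n w - z) = z - Z w.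
    by rewrite opprD addrACA subrr add0r opprK addrC.
  rewrite distrC => dC.
  set a := clip lam (X n w - Z w) in dC *; set a' := clip lam (X n w - z) in dC *.
  rewrite -lerBlDl; apply: (le_trans (lerB_dist _ _)).
  rewrite [X in `|X|](_ : _ = (truncated_walk i w - x) + ((a - a') + (Z w - z))).
    apply: (le_trans (ler_normD _ _)).
    have := ler_normD (a - a') (Z w - z); rewrite distrC in dC.
    by move: dS dZ dC; rewrite -/x -/z [`|z - _|]distrC; lra.
  rewrite opprD addrACA; congr (_ + _).
  by rewrite opprB addrA subrK opprD addrACA.
apply: (le_trans step1); rewrite ge0_integralZl_EFin//; last 2 first.
- by move=> w _; rewrite lee_fin ltW// cosh_gt0.
- by apply/measurable_EFinP; exact: measurable_funTS.
apply: (@le_trans _ _ ((expR (4 * (s * e)))%:E *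
    ((expR kappa * cosh (s * `|x|))%:E * P A))%E).
  by rewrite lee_wpmul2l ?lee_fin ?expR_ge0.
rewrite muleA -EFinM -integral_cst//; apply: ge0_le_integral => //.
- by move=> w _; rewrite lee_fin !mulr_ge0 ?expR_ge0 ?(ltW (cosh_gt0 _)).
- by apply/measurable_EFinP; apply: measurable_funTS; exact: measurable_funM.
move=> w Aw; rewrite lee_fin /=.
have -> : kappa + 5 * (s * e) = 4 * (s * e) + kappa + s * e by ring.
rewrite 2!expRD [leLHS]mulrA -[leRHS]mulrA ler_wpM2l ?mulr_ge0 ?expR_ge0//.
apply: le_trans (coshD_le _ _); last exact/ltW/mulr_gt0.
apply: le_cosh; first by rewrite mulr_ge0// ltW.
rewrite -mulrDr ler_pM2l// -lerBlDl (le_trans (lerB_dist _ _))// distrC ltW//.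
exact: hS.
Qed.

Let step_exp i A : F (k + i) A -> A `<=` D ->
  (\int[P]_(w in A) (U i.+1 w)%:E <= (expR kappa)%:E * \int[P]_(w in A) (U i w)%:E)%E.
Proof.
move=> FA AD; have mA := Fm FA.
have mUA j : measurable_fun A (fun w => (U j w)%:E).
  by apply/measurable_EFinP; exact: measurable_funTS.
have U0A j w : (0 <= (U j w)%:E)%E by rewrite lee_fin.
apply: lee_of_expR_eps.
- by apply: integral_ge0 => w _; exact: U0A.
- by rewrite mule_ge0 ?lee_fin ?expR_ge0 ?integral_ge0.
move=> t t0; pose e := t / (5 * s).
have e0 : 0 < e by apply: divr_gt0 => //; exact: mulr_gt0.
have te : 5 * (s * e) = t.
  by rewrite /e [LHS]mulrA mulrC divfK// gt_eqF// mulr_gt0.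
rewrite muleA -EFinM -expRD [t + _]addrC -ge0_integralZl_EFin ?expR_ge0//.
have mg : measurable_fun setT (fun w => expR (kappa + t) * U i w).
  exact: measurable_funM.
have g0 w : 0 <= expR (kappa + t) * U i w by rewrite mulr_ge0 ?expR_ge0.
apply: (@le_integral_localize _ _ _ _ P (F (k + i)) (@sF _) (@Fm _) sepB
  (truncated_walk i) (U i.+1) (fun w => expR (kappa + t) * U i w) e) => //.
  exact: truncated_walk_borel.
move=> A' w0 FA' A'A A'w0 hS.
apply: (@le_integral_localize _ _ _ _ P (F (k + i)) (@sF _) (@Fm _) sepB
  Z (U i.+1) (fun w => expR (kappa + t) * U i w) e) => //.
  by apply: borel_measS bZ; exact: Fk.
move=> A'' w1 FA'' A''A' A''w1 hZ.
rewrite -te; apply: (step_local (w0 := w0) (w1 := w1)) => //.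
  by apply: subset_trans AD; exact: subset_trans A'A.
by move=> w /A''A'; exact: hS.
Qed.

Lemma truncated_walk_maximal (c : R) : 0 < c ->
  (P ([set w | `|Z w - mu| < r]%R `&`
      \bigcup_i [set w | (c <= expR (- (kappa * i%:R)) *
        cosh (lam / beta * `|truncated_walk i w|))%R]) <= (c^-1)%:E)%E.
Proof.
move=> c0.
pose W i w := expR (- (kappa * i%:R)) * U i w.
have mW i : measurable_fun setT (W i) by exact: measurable_funM.
have W0 i w : 0 <= W i w by rewrite mulr_ge0 ?expR_ge0.
apply: (@ville_maximal _ _ _ P (fun i => F (k + i)) W D c) => //.
- by move=> n; rewrite addnS; exact: FS.
- move=> i; have -> : [set w | c <= W i w] =
      ~` (((fun y => expR (- (kappa * i%:R)) * y) \o U i) @^-1` [set t | t < c]).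
    by apply/seteqP; split=> w /=; rewrite leNgt => /negP.
  apply: sigma_setC => //.
  have cM : continuous (fun y : R => expR (- (kappa * i%:R)) * y).
    by move=> y; apply: cvgM; [exact: cvg_cst|exact: cvg_id].
  exact (borel_meas_comp cM (@bU i) (@open_lt _ _)).
- by rewrite addn0.
- move=> i A FA AD; have mA := Fm FA.
  have mUA j : measurable_fun A (fun w => (U j w)%:E).
    by apply/measurable_EFinP; exact: measurable_funTS.
  have Zl j (a : R) : 0 <= a -> (\int[P]_(w in A) (a * U j w)%:E =
      a%:E * \int[P]_(w in A) (U j w)%:E)%E.
    move=> a0; under eq_integral do rewrite EFinM.
    by apply: ge0_integralZl_EFin => // w _; rewrite lee_fin.
  rewrite /W !Zl ?expR_ge0//.
  have := step_exp FA AD; rewrite -(@lee_pmul2l _ (expR (- (kappa * i.+1%:R)))%:E)//;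
    last by rewrite lte_fin expR_gt0.
  rewrite muleA -EFinM -expRD.
  by rewrite (_ : - (kappa * i.+1%:R) + kappa = - (kappa * i%:R))// -natr1; ring.
- apply: (@le_trans _ _ (\int[P]_(w in D) (cst 1%:E w))%E).
    apply: ge0_le_integral => //.
    + exact: (Fm FD).
    + by move=> w _; rewrite lee_fin.
    + by apply/measurable_EFinP; exact: measurable_funTS.
    + move=> w _; rewrite lee_fin /W mulr0 oppr0 expR0 mul1r /U /truncated_walk.
      by rewrite addn0 big_geq// normr0 mulr0 cosh0.
  by rewrite integral_cst ?mul1e ?probability_le1//; exact: (Fm FD).
Qed.

End TruncatedWalk.

(** * Tuning of lambda and the bound on one dyadic level *)

Lemma tuned_rate {R : realType} (p C x y lam : R) : 1 < p -> 0 < C -> 0 < x ->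
  y <= 2 * x -> x <= 2 * y ->
  lam = (y / C) `^ p^-1 ->
  x / lam + lam `^ (p - 1) * C <=
  (2 `^ ((p - 1) / p) + 2 `^ p^-1) * C `^ p^-1 * x `^ ((p - 1) / p).
Proof.
move=> p1 C0 x0 yx xy lamE.
have p0 : 0 < p by lra.
have y0 : 0 < y by lra.
set q := p^-1; have q0 : 0 <= q by rewrite invr_ge0 ltW.
have -> : (p - 1) / p = 1 - q by rewrite /q; field; rewrite gt_eqF.
have q1 : 0 <= 1 - q by rewrite subr_ge0 invf_le1// ltW.
have CE : C = C `^ q * C `^ (1 - q).
  by rewrite -powRD ?(gt_eqF C0) ?implybT// addrC subrK powRr1// ltW.
have xE : x = x `^ q * x `^ (1 - q).
  by rewrite -powRD ?(gt_eqF x0) ?implybT// addrC subrK powRr1// ltW.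
(* The two terms of the rate match the two of the sum: [yx] bounds lam^(p-1) C with factor
   2^((p-1)/p), [xy] bounds x/lam with factor 2^(1/p). *)
rewrite addrC -mulrA mulrDl lerD//.
  have -> : lam `^ (p - 1) = y `^ (1 - q) / C `^ (1 - q).
    rewrite lamE -powRrM (_ : p^-1 * (p - 1) = 1 - q); last first.
      by rewrite /q; field; rewrite gt_eqF.
    rewrite powRM ?invr_ge0 ?ltW//; congr (_ * _).
    by rewrite -powR_inv1 ?ltW// -powRrM mulN1r powRN.
  have E : C / C `^ (1 - q) = C `^ q by rewrite {1}CE mulfK// gt_eqF// powR_gt0.
  rewrite mulrAC -mulrA E [leRHS]mulrCA mulrC ler_wpM2l ?powR_ge0//.
  by rewrite -powRM ?(ltW x0)// ge0_ler_powR ?nnegrE ?(ltW y0) ?mulr_ge0 ?(ltW x0).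
have -> : lam^-1 = C `^ q / y `^ q.
  rewrite lamE -/q powRM ?invr_ge0 ?ltW// invfM mulrC; congr (_ * _).
  by rewrite -powR_inv1 ?ltW// -powRrM mulN1r powRN invrK.
have h : x `^ q <= 2 `^ q * y `^ q.
  by rewrite -powRM ?(ltW y0)// ge0_ler_powR ?nnegrE ?(ltW x0) ?mulr_ge0 ?(ltW y0).
rewrite {1}xE mulrA ler_pdivrMr ?powR_gt0//.
have -> : 2 `^ q * (C `^ q * x `^ (1 - q)) * y `^ q =
  (2 `^ q * y `^ q) * (x `^ (1 - q) * C `^ q) by ring.
by rewrite -mulrA ler_wpM2r// mulr_ge0 ?powR_ge0.
Qed.

(** [Bad] is chosen before n, so one exceptional event serves a whole block. Here tau stands for
    2^j, of which only the comparison with n - k matters. *)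
Lemma truncated_mean_level {R : realType} {B : completeNormedModType R}
  {d : measure_display} {Omega : measurableType d} (P : probability Omega R)
  (F : nat -> set (set Omega)) (X : nat -> Omega -> B) (mu : B)
  (beta p v r tau dj : R) (k : nat) (Z : Omega -> B) :
  separable B -> beta_smooth B beta -> 1 <= beta -> filtration F ->
  (forall n, (1 <= n)%N -> borel_meas (F n) (X n)) ->
  (forall n, (1 <= n)%N -> cond_exp_eq P (F n.-1) (X n) mu) ->
  1 < p <= 2 ->
  (forall n, (1 <= n)%N -> cond_exp_le P (F n.-1) (fun w => `|X n w - mu| `^ p) v) ->
  borel_meas (F k) Z -> 0 < v -> 0 < r -> 0 < tau -> 0 < dj < 1 ->
  (P [set w | (r <= `|Z w - mu|)%R] <= (dj / 2)%:E)%E ->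
  let C := (beta * Cfrak B beta p + 2 `^ (p - 1) * Kp p) * (v + r `^ p) in
  let lam := (beta * ln (4 / dj) / (tau * C)) `^ p^-1 in
  exists Bad : set Omega, [/\ measurable Bad, (P Bad <= dj%:E)%E &
    forall w, ~ Bad w -> forall n, (k < n)%N ->
      tau <= 2 * (n%:R - k%:R) -> n%:R - k%:R <= 2 * tau ->
      `|(n%:R - k%:R)^-1 *: \sum_(k.+1 <= m < n.+1)
           (Trunc (lam *: (X m w - Z w)) *: (X m w - Z w) + Z w) - mu| <=
      Bfrak B beta p * (v + r `^ p) `^ p^-1 *
      (beta * ln (4 / dj) / (n%:R - k%:R)) `^ ((p - 1) / p)].
Proof.
move=> sepB smoothB beta1 filtF adX meanX p12 momX bZ v0 r0 tau0 /andP[dj0 dj1]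
  tailZ C lam.
have p1 : 1 < p by case/andP: p12.
have beta0 : 0 < beta by exact: lt_le_trans beta1.
have [sF [Fm FS]] := filtF.
set L := ln (4 / dj).
have L0 : 0 < L by rewrite ln_gt0// ltr_pdivlMr//; lra.
have V0 : 0 < v + r `^ p by rewrite ltr_wpDr ?powR_ge0.
have Cf0 : 0 <= Cfrak B beta p.
  rewrite /Cfrak; apply: mulr_ge0; first by case: ifP => _; exact: powR_ge0.
  by rewrite divr_ge0 ?sqr_ge0//; have := expR_ge1Dx (2 / beta); lra.
have K0 := Kp_gt0 p1.
have M0 : 0 < beta * Cfrak B beta p + 2 `^ (p - 1) * Kp p.
  apply: ltr_wpDl; first by apply: mulr_ge0 => //; exact: ltW.
  by apply: mulr_gt0 => //; exact: powR_gt0.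
have C0 : 0 < C by exact: mulr_gt0.
have lam0 : 0 < lam.
  by apply: powR_gt0; apply: divr_gt0; apply: mulr_gt0.
pose kappa := @step_exponent R B beta p v r lam.
(* At this threshold the maximal inequality costs dj/2; the tail of Z takes the other half. *)
pose c := 2 / dj.
have c0 : 0 < c by rewrite divr_gt0.
pose H := [set w | r <= `|Z w - mu|].
pose W i := [set w | c <= expR (- (kappa * i%:R)) *
  cosh (lam / beta * `|truncated_walk X mu lam k Z i w|)].
pose V := [set w | `|Z w - mu| < r] `&` \bigcup_i W i.
have FD : F k [set w | `|Z w - mu| < r] by exact: borel_meas_ball.
have mH : measurable H.
  rewrite (_ : H = ~` [set w | `|Z w - mu| < r]); first exact/measurableC/(Fm k).
  by apply/seteqP; split=> w /=; rewrite /H /= leNgt => /negP.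
have mW i : measurable (W i).
  pose phi (y : B) := expR (- (kappa * i%:R)) * cosh (lam / beta * `|y|).
  have cphi : continuous phi.
    move=> y; apply: cvgM; first exact: cvg_cst.
    apply: (@continuous_comp _ _ _ (fun y : B => lam / beta * `|y|) cosh).
      by apply: cvgM; [exact: cvg_cst|apply: cvg_norm; exact: cvg_id].
    exact: continuous_cosh.
  have bw : borel_meas (F (k + i)) (truncated_walk X mu lam k Z i).
    by apply: truncated_walk_borel.
  rewrite (_ : W i = ~` ((phi \o truncated_walk X mu lam k Z i) @^-1` [set t | t < c])).
    apply: measurableC; apply: (Fm (k + i)).
    exact (borel_meas_comp cphi bw (@open_lt _ _)).
  by apply/seteqP; split=> w /=; rewrite /W /= leNgt => /negP.
have mV : measurable V.
  by apply: measurableI; [exact: (Fm k)|exact: bigcupT_measurable].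
have PV : (P V <= (dj / 2)%:E)%E.
  have := @truncated_walk_maximal _ _ _ _ P F X mu beta p v r lam sepB smoothB
    beta1 filtF adX meanX p12 momX lam0 k Z bZ c c0.
  by rewrite /c invf_div.
exists (H `|` V); split; first exact: measurableU.
  apply: (le_trans (measureU2 P mH mV)).
  by rewrite [in leRHS](splitr dj) EFinD leeD.
move=> w /not_orP[nH nV] n kn tauN Ntau.
have Zr : `|Z w - mu| < r by rewrite ltNge; apply/negP.
set N := n%:R - k%:R in tauN Ntau *.
have N0 : 0 < N by rewrite subr_gt0 ltr_nat.
have NE : N = (n - k)%:R by rewrite natrB// ltnW.
set S := truncated_walk X mu lam k Z (n - k) w.
pose y m := Trunc (lam *: (X m w - Z w)) *: (X m w - Z w) + Z w.
have SE : S = \sum_(k.+1 <= m < n.+1) y m - mu *+ (n - k).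
  have kE : (k + (n - k))%N = n by rewrite subnKC// ltnW.
  rewrite /S /truncated_walk kE (eq_bigr (fun m => y m - mu))//.
  rewrite (@sumrB _ _ _ _ y (fun=> mu)); congr (_ - _).
  by rewrite sumr_const_nat subSS.
have -> : N^-1 *: \sum_(k.+1 <= m < n.+1) y m - mu = N^-1 *: S.
  by rewrite SE scalerBr -scaler_nat -NE scalerA mulVf ?gt_eqF// scale1r.
have SW : expR (- (kappa * N)) * cosh (lam / beta * `|S|) < c.
  rewrite ltNge; apply/negP => h; apply: nV; split=> //; exists (n - k)%N => //.
  by rewrite /W /= -NE.
have s0 : 0 < lam / beta by rewrite divr_gt0.
have Sle : lam / beta * `|S| <= L + kappa * N.
  rewrite -ler_expR expRD lnK ?posrE ?divr_gt0//.
  have h := half_expR_le_cosh (lam / beta * `|S|).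
  move: SW; rewrite expRN mulrC ltr_pdivrMr ?expR_gt0// => SW.
  have := le_lt_trans h SW; rewrite /c ltr_pdivrMr// => h'.
  by apply: (le_trans (ltW h')); rewrite le_eqVlt; apply/orP; left; apply/eqP; ring.
(* kappa equals lam^p C / beta, so the growth of the walk becomes the second term of
   [tuned_rate]. *)
have kE : beta * kappa / lam = lam `^ (p - 1) * C.
  rewrite /kappa /step_exponent -(@mulr_powRB1 _ lam p) ?(ltW lam0)//; last by lra.
  by rewrite /C; field; rewrite !gt_eqF.
have dev : `|N^-1 *: S| <= beta * L / N / lam + lam `^ (p - 1) * C.
  rewrite normrZ gtr0_norm ?invr_gt0// -kE ler_pdivrMl//.
  have -> : N * (beta * L / N / lam + beta * kappa / lam) =
      (L + kappa * N) / (lam / beta).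
    by field; rewrite !gt_eqF.
  by rewrite ler_pdivlMr// mulrC.
apply: (le_trans dev).
have x0 : 0 < beta * L / N by rewrite divr_gt0// mulr_gt0.
have bL : 0 < beta * L by exact: mulr_gt0.
have := @tuned_rate _ p C (beta * L / N) (beta * L / tau) lam p1 C0 x0.
move=> /(_ _ _ _)/wrap[].
- by rewrite mulrCA ler_pM2l// ler_pdivlMr// mulrC ler_pdivrMr.
- by rewrite mulrCA ler_pM2l// ler_pdivlMr// mulrC ler_pdivrMr.
- by rewrite /lam -[beta * L / tau / C]mulrA -invfM.
move=> /le_trans; apply; rewrite ler_wpM2r ?powR_ge0//.
rewrite /Bfrak -[leRHS]mulrA -powRM ?(ltW V0)//; last first.
  by rewrite (mulrC (Kp p)) ltW.
by rewrite (mulrC (Kp p)).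
Qed.

(** * Union bound over the dyadic levels *)

Theorem theorem2 (R : realType) (B : completeNormedModType R) (beta : R)
  (d : measure_display) (Omega : measurableType d) (P : probability Omega R)
  (F : nat -> set (set Omega)) (X : nat -> Omega -> B) (mu : B) (p v : R)
  (h : R -> R) (n0 : nat) (k : nat -> nat)
  (Zhat : forall m : nat, {ptws 'I_m -> B} -> B) (r : R -> nat -> R)
  (delta : R) :
  (* B separable, beta-smooth Banach space *)
  separable B -> 0 < beta -> beta_smooth B beta ->
  (* (X_n) adapted to the filtration (F_n) *)
  filtration F ->
  (forall n, (1 <= n)%N -> borel_meas (F n) (X n)) ->
  (* E(X_n | F_{n-1}) = mu *)
  (forall n, (1 <= n)%N -> cond_exp_eq P (F n.-1) (X n) mu) ->
  (* sup_n E(||X_n - mu||^p | F_{n-1}) <= v *)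
  1 < p <= 2 -> 0 < v ->
  (forall n, (1 <= n)%N -> cond_exp_le P (F n.-1) (fun w => `|X n w - mu| `^ p) v) ->
  (* h : R_{>=0} -> R_{>=0} with sum_{n>=1} 1/h(n) <= 1 *)
  (forall x, 0 <= x -> 0 <= h x) ->
  (forall n, (1 <= n)%N -> 0 < h n%:R) ->
  (\sum_(1 <= n <oo) ((h n%:R)^-1)%:E <= 1)%E ->
  (* n0 positive, k increasing with (i) and (ii) *)
  (0 < n0)%N ->
  {homo k : a b / (a <= b)%N} ->
  (fun n : nat => (k (trunc_log 2 n))%:R / (n%:R : R)) @ \oo --> 0 ->
  (forall l, (n0 <= l)%N -> ((k l)%:R <= (l%:R : R) / 2)) ->
  (* hat Z measurable; tail bound for hat Z_j *)
  (forall m, borel_meas (@borel_sets {ptws 'I_m -> B}) (Zhat m)) ->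
  (forall (del : R) (j : nat), 0 < del < 1 ->
     (P [set w | (r del (k j) <= `|Zj Zhat k X j w - mu|)%R ] <= del%:E)%E) ->
  0 < delta < 1 ->
  exists A : set Omega, measurable A /\ ((1 - delta)%:E <= P A)%E /\
    forall w, A w -> forall n : nat, (n0 <= n)%N -> (2 <= n)%N ->
      `|muhat Zhat X beta p v r k h delta n w - mu| <=
        Bfrak B beta p *
        (v + r ((h (trunc_log 2 n)%:R)^-1 * delta / 2) (k (trunc_log 2 n)) `^ p)
          `^ p^-1 *
        (beta * ln (4 * h (trunc_log 2 n)%:R / delta) /
           (n%:R - (k (trunc_log 2 n))%:R)) `^ ((p - 1) / p).
Proof.
move=> sepB beta0 smoothB filtF adX meanX p12 v0 momX h0 hpos hsum _ kmono _ khalf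
  bZhat tailZ /andP[delta0 delta1].
(* In the zero space beta >= 1 may fail, but there every norm vanishes. *)
have [[x0 x0n0]|trivB] := pselect (exists x : B, x != 0); last first.
  exists setT; split => //; split.
    by rewrite probability_setT lee_fin; lra.
  move=> w _ n _ _; have -> : forall y : B, `|y| = 0.
    move=> y; apply/eqP; rewrite normr_eq0; apply/negPn/negP => y0.
    by apply: trivB; exists y.
  apply: mulr_ge0; last exact: powR_ge0.
  apply: mulr_ge0; last exact: powR_ge0.
  by rewrite /Bfrak mulr_ge0 ?addr_ge0 ?powR_ge0.
have beta1 := beta_smooth_ge1 smoothB x0n0 beta0.
have [sF [Fm FS]] := filtF.
(* Each single term of the sum is at most 1; this keeps delta_j below 1. *)
have h1 j : (1 <= j)%N -> 1 <= h j%:R.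
  move=> j1; have hj := hpos _ j1; rewrite -invf_le1//.
  rewrite -lee_fin; apply: le_trans hsum.
  apply: le_trans (@nneseries_lim_ge _ _ xpredT 1 j.+1 _); last first.
    by move=> n n1 _; rewrite lee_fin invr_ge0 ltW// hpos.
  rewrite big_nat_recr//= leeDr// big_nat_cond.
  by apply: sume_ge0 => i /andP[/andP[i1 _] _]; rewrite lee_fin invr_ge0 ltW// hpos.
have dj01 j : (1 <= j)%N -> 0 < deltaj h delta j < 1.
  move=> j1; have hj := hpos _ j1; rewrite /deltaj divr_gt0//= ltr_pdivrMr// mul1r.
  exact: lt_le_trans (h1 _ j1).
pose rj j := r (deltaj h delta j / 2) (k j).
have tail_j j : (1 <= j)%N ->
    (P [set w | (rj j <= `|Zj Zhat k X j w - mu|)%R] <= (deltaj h delta j / 2)%:E)%E.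
  by move=> j1; apply: tailZ; have /andP[d0 d1] := dj01 _ j1; apply/andP; split; lra.
(* If r_j <= 0, the tail event would be the whole space, whose probability 1 exceeds delta_j/2. *)
have rj0 j : (1 <= j)%N -> 0 < rj j.
  move=> j1; rewrite ltNge; apply/negP => r_le0; have := tail_j j j1.
  rewrite (_ : mkset _ = setT); last first.
    by apply/seteqP; split=> // w _ /=; exact: le_trans r_le0 _.
  by rewrite probability_setT lee_fin; have /andP[d0 d1] := dj01 _ j1; lra.
have bZ j : borel_meas (F (k j)) (Zj Zhat k X j).
  have Fle m n : (m <= n)%N -> F m `<=` F n.
    move=> /subnKC <-; elim: (n - m)%N => [|i IH]; first by rewrite addn0.
    by rewrite addnS; exact: subset_trans (FS _).
  apply: (borel_meas_estimator (sF _) sepB (bZhat (k j)) (Y := fun i => X i.+1)) => i.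
  by apply: borel_measS (adX _ _) => //; exact: Fle.
have level j : exists Bad : set Omega, (1 <= j)%N ->
    [/\ measurable Bad, (P Bad <= (deltaj h delta j)%:E)%E &
    forall w, ~ Bad w -> forall n, (k j < n)%N ->
      2 ^+ j <= 2 * (n%:R - (k j)%:R) :> R -> n%:R - (k j)%:R <= 2 * 2 ^+ j :> R ->
      `|muhatj Zhat X beta p v r k h delta n j w - mu| <=
      Bfrak B beta p * (v + rj j `^ p) `^ p^-1 *
      (beta * ln (4 / deltaj h delta j) / (n%:R - (k j)%:R)) `^ ((p - 1) / p)].
  have [j1|j0] := leqP 1 j; last by exists set0.
  have [Bad HB] := @truncated_mean_level _ _ _ _ P F X mu beta p v (rj j) (2 ^+ j)
    (deltaj h delta j) (k j) (Zj Zhat k X j) sepB smoothB beta1 filtF adX meanX p12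
    momX (bZ j) v0 (rj0 j j1) (exprn_gt0 j (ltr0n R 2)) (dj01 j j1) (tail_j j j1).
  by exists Bad => _.
have /choice[Bad0 HBad] := level.
(* Level 0 does not occur for n >= 2 and the sum of 1/h starts at 1, so level 0 gets the empty
   event. *)
pose Bad j := if j is 0%N then set0 else Bad0 j.
have BadE j : (1 <= j)%N -> Bad j = Bad0 j by case: j.
have mBad j : measurable (Bad j).
  by case: j => //= j; have [] := HBad j.+1 isT.
exists (~` \bigcup_j Bad j); split.
  by apply: measurableC; exact: bigcupT_measurable.
have mU : measurable (\bigcup_j Bad j) by exact: bigcupT_measurable.
split.
  have PU : (P (\bigcup_j Bad j) <= delta%:E)%E.
    apply: (le_trans (@measure_sigma_subadditive _ _ _ P _ _ mBad mU (@subset_refl _ _))).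
    rewrite (@nneseries_split _ _ 0 1)// big_nat1 measure0 add0e.
    apply: (@le_trans _ _ (\sum_(1 <= j <oo) (delta%:E * ((h j%:R)^-1)%:E))%E).
      apply: lee_nneseries => // -[|j] _ /=.
        by rewrite measure0 -EFinM lee_fin mulr_ge0 ?invr_ge0 ?h0// ltW.
      by have [_ Pj _] := HBad j.+1 isT; rewrite -EFinM.
    rewrite nneseriesZl; last by move=> i _; rewrite lee_fin invr_ge0 h0.
    by rewrite -[leRHS]mule1 lee_wpmul2l// lee_fin ltW.
  by rewrite probability_setC// EFinB leeB.
move=> w nBad n n0n n2; set j := trunc_log 2 n.
have j1 : (1 <= j)%N by rewrite trunc_log_gt0.
have /andP[lo hi] : (2 ^ j <= n < 2 ^ j.+1)%N.
  by rewrite trunc_logP ?trunc_log_ltn//; exact: ltn_trans n2.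
(* The bound on k is applied at n, since j may lie below n0; monotonicity with j <= n brings it back
   to k(j). It yields 2^j <= n <= 2(n - k(j)). *)
have kn : (k j)%:R <= (n%:R / 2 : R).
  apply: le_trans (khalf _ n0n); rewrite ler_nat kmono//.
  by apply: leq_trans lo; rewrite ltnW// ltn_expl.
have nR : 2 <= n%:R :> R by rewrite ler_nat.
have loR : 2 ^+ j <= n%:R :> R by rewrite -natrX ler_nat.
have hiR : n%:R <= 2 * 2 ^+ j :> R by rewrite -exprS -natrX ler_nat ltnW.
have kR : 0 <= (k j)%:R :> R by [].
have [_ _ H] := HBad j j1.
have := H w _ n; rewrite /muhat -/j.
have -> : (h j%:R)^-1 * delta / 2 = deltaj h delta j / 2.
  by rewrite /deltaj (mulrC delta).
have -> : 4 * h j%:R / delta = 4 / deltaj h delta j.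
  by rewrite /deltaj invf_div mulrA.
apply.
- by move=> bw; apply: nBad; exists j => //; rewrite BadE.
- by rewrite -(ltr_nat R); lra.
- by lra.
- by lra.
Qed.
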